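(* Let $\mathbb K$ be an infinite field, $n\geq 2$, $R=\mathbb K[x_1,\ldots,x_n]$, and let $\boldsymbol d=(d_1,\ldots,d_m)$ with $2\leq d_1\leq\cdots\leq d_m$. With $\mathbb P_{\mathbb K,\boldsymbol d}$, $\tau_{\boldsymbol d}$, $t_0$, $r$ and $\mathfrak N_{t_0,\boldsymbol d}$ as defined in the context, set $U_{t_0}:=\mathbb P_{\mathbb K,\boldsymbol d}\setminus V(I_r(\mathfrak N_{t_0,\boldsymbol d}))$. Then: (a) Given a set of forms $\mathbf f=\{f_1,\ldots,f_m\}\subset R$ of degrees $d_1,\ldots,d_m$ respectively, the ideal $\langle I_m(\Theta(\mathbf f)),\mathbf f\rangle\subset R$ has height $n$ if and only if $\tau_{\boldsymbol d}(f_1,\ldots,f_m)\in U_{t_0}$. (b) The Zariski open subset $U_{t_0}$ is nonempty.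
   Context: For a set of forms $\mathbf f=\{f_1,\ldots,f_m\}$, $\Theta(\mathbf f)$ is the $m\times n$ Jacobian matrix $(\partial f_i/\partial x_j)$, and $I_s(\cdot)$ is the ideal generated by the $s\times s$ minors of a matrix (zero if there are none). Parameter space: $\mathbb P_{\mathbb K,\boldsymbol d}=\mathbb P^{N_1}_{\mathbb K}\times\cdots\times\mathbb P^{N_m}_{\mathbb K}$ with $N_i=\binom{d_i+n-1}{n-1}-1$; $\tau_{\boldsymbol d}$ sends an $m$-tuple of nonzero forms $(f_1,\ldots,f_m)$, $\deg f_i=d_i$, to the point whose $i$-th component has as coordinates the coefficients of $f_i$. Let $\mathbb S=\mathbb K[y^{(d_1)}_{\alpha}: |\alpha|=d_1]\otimes_{\mathbb K}\cdots\otimes_{\mathbb K}\mathbb K[y^{(d_m)}_{\alpha}: |\alpha|=d_m]$ ($\alpha\in\mathbb N^n$; separate variables for each of the $m$ factors) be the multigraded coordinate ring of $\mathbb P_{\mathbb K,\boldsymbol d}$, let $\mathfrak f_j=\sum_{|\alpha|=d_j}y^{(d_j)}_{\alpha}x_1^{\alpha_1}\cdots x_n^{\alpha_n}\in\mathbb S[x_1,\ldots,x_n]$ be the generic form of degree $d_j$ (with the variables of the $j$-th factor), $\boldsymbol{\mathfrak f}=\{\mathfrak f_1,\ldots,\mathfrak f_m\}$, let $\Theta(\boldsymbol{\mathfrak f})$ be its Jacobian matrix with respect to $x_1,\ldots,x_n$, and let $\boldsymbol{\mathfrak g}$ be the set of $m$-minors of $\Theta(\boldsymbol{\mathfrak f})$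 (so $\boldsymbol{\mathfrak g}=\emptyset$ if $m>n$). Put $\delta=\max\{\deg_{\mathbf x}\mathfrak h : \mathfrak h\in\boldsymbol{\mathfrak g}\cup\boldsymbol{\mathfrak f}\}$, where $\deg_{\mathbf x}$ is the degree in $x_1,\ldots,x_n$. For $t\geq\delta$, $\mathfrak N_{t,\boldsymbol d}$ is the matrix over $\mathbb S$ whose columns are indexed by the $\binom{t+n-1}{n-1}$ monomials of degree $t$ in $x_1,\ldots,x_n$, whose rows are indexed by the products $\mathfrak h\,x_1^{\alpha_1}\cdots x_n^{\alpha_n}$ with $\mathfrak h\in\boldsymbol{\mathfrak g}\cup\boldsymbol{\mathfrak f}$ and $\alpha_1+\cdots+\alpha_n=t-\deg_{\mathbf x}\mathfrak h$, and whose entries are the coefficients in $\mathbb S$ of these monomials in these products. Finally $t_0=n(\delta-1)+1$ and $r=\binom{t_0+n-1}{n-1}=\binom{n\delta}{n-1}$. The ideal $I_r(\mathfrak N_{t_0,\boldsymbol d})\subset\mathbb S$ is multihomogeneous and $V(\cdot)$ denotes its zero set in $\mathbb P_{\mathbb K,\boldsymbol d}$. *)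

(* Defs.v *)
From HB Require Import structures.
From mathcomp Require Export all_boot all_order all_algebra.
From mathcomp.multinomials Require Export mpoly.

Set Implicit Arguments.
Unset Strict Implicit.
Unset Printing Implicit Defensive.

Import GRing.Theory.
Local Open Scope ring_scope.

(* * Ideals and height *)

Definition in_ideal (R : comNzRingType) (gs : seq R) (p : R) : Prop :=
  exists c : 'I_(size gs) -> R, p = \sum_i c i * gs`_i.

(* [prime_idealr R] consists of boolean predicates, which is no restriction
   classically. *)
Definition prime_chain (R : nzRingType) (l : nat) (P : nat -> prime_idealr R) :=
  forall i, (i < l)%N ->
    {subset (P i : {pred R}) <= (P i.+1 : {pred R})} /\
    (exists2 x, x \in (P i.+1 : {pred R}) & x \notin (P i : {pred R})).

Definition prime_height_ge (R : nzRingType) (Q : prime_idealr R) (l : nat) :=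
  exists2 P : nat -> prime_idealr R, prime_chain l P & P l =i Q.

Definition height_ge (R : nzRingType) (I : R -> Prop) (l : nat) : Prop :=
  forall Q : prime_idealr R,
    (forall x, I x -> x \in (Q : {pred R})) -> prime_height_ge Q l.

(* The height of I is the least height of a prime containing I, the height of a
   prime Q being the largest l with a chain P_0 < ... < P_l = Q of primes; thus
   the unit ideal has height h for no natural number h. *)
Definition has_height (R : nzRingType) (I : R -> Prop) (h : nat) : Prop :=
  height_ge I h /\ ~ height_ge I h.+1.

(* * Minors *)

Definition increasing (s p : nat) (u : {ffun 'I_s -> 'I_p}) : bool :=
  [forall i : 'I_s, forall j : 'I_s, (i < j)%N ==> (u i < u j)%N].

(* Sets of generators are represented by lists: repetitions change neither the
   ideals they generate nor the ideals of minors below. *)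
Definition minors (R : comNzRingType) (s p q : nat) (M : 'M[R]_(p, q)) : seq R :=
  [seq \det (mxsub u.1 u.2 M)
     | u : {ffun 'I_s -> 'I_p} * {ffun 'I_s -> 'I_q}
         in [pred u | increasing u.1 && increasing u.2]].

Definition minor_ideal (R : comNzRingType) (s p q : nat) (M : 'M[R]_(p, q)) :
  R -> Prop := in_ideal (minors s M).

Definition jacobian (A : comNzRingType) (m n : nat) (f : 'I_m -> {mpoly A[n]}) :
  'M[{mpoly A[n]}]_(m, n) := \matrix_(i, j) (f i)^`M(j).

Definition minors_and_forms (A : comNzRingType) (m n : nat)
    (f : 'I_m -> {mpoly A[n]}) : seq {mpoly A[n]} :=
  minors m (jacobian f) ++ [seq f i | i : 'I_m].

(* * Forms and the parameter space *)

Definition expo (n d : nat) : predArgType :=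
  {a : 'X_{1..n < d.+1} | mdeg a == d}.
HB.instance Definition _ (n d : nat) := SubFinite.on (expo n d).

Definition expo_mnm (n d : nat) (a : expo n d) : 'X_{1..n} := val (val a).
Coercion expo_mnm : expo >-> multinom.

Definition nzform (K : fieldType) (n d : nat) : Type :=
  {f : {mpoly K[n]} | (f \is d.-homog) && (f != 0)}.

Record proj_space (K : fieldType) (V : vectType K) : Type := ProjPoint {
  proj_line :> {vspace V};
  dim_proj_line : \dim proj_line == 1%N
}.

Definition coef_space (K : fieldType) (n d : nat) : vectType K :=
  {ffun expo n d -> K^o}.

Definition param_space (K : fieldType) (n m : nat) (d : 'I_m -> nat) : Type :=
  forall i : 'I_m, proj_space (coef_space K n (d i)).

Definition coefs (K : fieldType) (n d : nat) (f : {mpoly K[n]}) :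
  coef_space K n d := [ffun a : expo n d => f@_a : K^o].

Lemma dim_coefs_line (K : fieldType) (n d : nat) (f : nzform K n d) :
  \dim <[coefs d (sval f)]>%VS == 1%N.
Proof.
case: f => f /= /andP[fd f_neq0]; rewrite dim_vline eqb1.
apply: contraNneq f_neq0 => c0; apply/eqP/mpolyP => a; rewrite mcoeff0.
have [a_f|/memN_msupp_eq0//] := boolP (a \in msupp f).
have da : mdeg a = d by move/dhomogP: fd; apply.
have ltad : (mdeg a < d.+1)%N by rewrite da.
have dab : mdeg (BMultinom ltad) == d by apply/eqP.
by have /ffunP/(_ (Sub (BMultinom ltad) dab)) := c0; rewrite !ffunE.
Qed.

Definition tau (K : fieldType) (n m : nat) (d : 'I_m -> nat)
    (f : forall i, nzform K n (d i)) : param_space K n d :=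
  fun i => ProjPoint (dim_coefs_line (f i)).

(* * The generic forms *)

Definition coord_index (n m : nat) (d : 'I_m -> nat) : finType :=
  {j : 'I_m & expo n (d j)}.

(* The tensor product of the m polynomial rings, as the polynomial ring in the
   disjoint union of their variables. *)
Notation coord_ring K n d := {mpoly K[#|coord_index n d|]}.

Definition coord_var (K : fieldType) (n m : nat) (d : 'I_m -> nat)
    (j : 'I_m) (a : expo n (d j)) : coord_ring K n d :=
  'X_(enum_rank (Tagged (fun j => expo n (d j)) a : coord_index n d)).

(* F vanishes at all the multihomogeneous coordinate vectors of the point. *)
Definition vanishes_at (K : fieldType) (n m : nat) (d : 'I_m -> nat)
    (F : coord_ring K n d) (x : param_space K n d) : Prop :=
  forall v : forall j, coef_space K n (d j),
    (forall j, v j \in (x j : {vspace _}) /\ v j != 0) ->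
    F.@[fun k => v (tag (enum_val k)) (tagged (enum_val k))] = 0.

Definition zero_set (K : fieldType) (n m : nat) (d : 'I_m -> nat)
    (I : coord_ring K n d -> Prop) (x : param_space K n d) : Prop :=
  forall F, I F -> vanishes_at F x.

Definition generic_form (K : fieldType) (n m : nat) (d : 'I_m -> nat)
    (j : 'I_m) : {mpoly (coord_ring K n d)[n]} :=
  \sum_(a : expo n (d j)) coord_var K a *: 'X_[a].

Definition generic_gens (K : fieldType) (n m : nat) (d : 'I_m -> nat) :=
  minors_and_forms (@generic_form K n m d).

(* Convention: xdeg 0 = 0.  A zero minor thus has no influence on delta below,
   and contributes only zero rows to Nmx. *)
Definition xdeg (A : nzRingType) (n : nat) (h : {mpoly A[n]}) : nat :=
  (msize h).-1.

Definition delta (K : fieldType) (n m : nat) (d : 'I_m -> nat) : nat :=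
  \max_(h <- generic_gens K n d) xdeg h.

Definition t0 (K : fieldType) (n m : nat) (d : 'I_m -> nat) : nat :=
  (n * (delta K n d - 1) + 1)%N.

Definition rows_N (K : fieldType) (n m : nat) (d : 'I_m -> nat) (t : nat) :=
  [seq h * 'X_[expo_mnm a]
    | h <- generic_gens K n d, a <- enum {: expo n (t - xdeg h)}].

Definition Nmx (K : fieldType) (n m : nat) (d : 'I_m -> nat) (t : nat) :
    'M[coord_ring K n d]_(size (rows_N K n d t), #|expo n t|) :=
  \matrix_(i, j) ((rows_N K n d t)`_i)@_(enum_val j : expo n t).

Definition U_set (K : fieldType) (n m : nat) (d : 'I_m -> nat) (t : nat)
    (x : param_space K n d) : Prop :=
  ~ zero_set (minor_ideal 'C(t + n - 1, n - 1) (Nmx K n d t)) x.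

(* Main.v *)
(* A homogeneous ideal J of K[x_1,...,x_n] generated by forms of positive
   degree has height n exactly when it contains a power of every variable: if X_i
   is not in the radical of J, then J has a homogeneous prime strictly below the
   irrelevant ideal, whose height is at most n because n + 1 polynomials in n
   variables are algebraically dependent. If J is generated in degrees at most
   delta and contains powers of the variables then, K being infinite, n linear
   combinations of its forms of degree delta already generate an ideal containing
   powers of the variables, and Macaulay's bound (proved by comparing the Koszul
   complexes of these forms and of powers of the variables) shows that J contains
   all the forms of degree t0 = n (delta - 1) + 1, that is, that the specialized
   matrix N has full rank. For the nonemptiness of U, the criterion is applied
   over the fraction field of the coordinate ring: if the generic forms had a
   common zero at which their Jacobian matrix drops rank, their coefficients
   would be algebraic expressions in too few elements; this count is valid in
   every characteristic. *)

From HB Require Import structures.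
From mathcomp Require boolp classical_sets.
From mathcomp Require Import ring zify.
Require Import Defs.

Set Implicit Arguments.
Unset Strict Implicit.
Unset Printing Implicit Defensive.

Import GRing.Theory.
Local Open Scope ring_scope.

(** * Ideals and primes *)

Section Ideals.
Variable R : comNzRingType.
Implicit Types (gs hs : seq R) (p q : R).

Lemma in_ideal0 gs : in_ideal gs 0.
Proof. by exists (fun=> 0); rewrite big1 // => i _; rewrite mul0r. Qed.

Lemma in_idealD gs p q : in_ideal gs p -> in_ideal gs q -> in_ideal gs (p + q).
Proof.
move=> [c ->] [c' ->]; exists (fun i => c i + c' i).
by rewrite -big_split; apply: eq_bigr => i _; rewrite mulrDl.
Qed.

Lemma in_idealMl gs p q : in_ideal gs q -> in_ideal gs (p * q).
Proof.
move=> [c ->]; exists (fun i => p * c i).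
by rewrite mulr_sumr; apply: eq_bigr => i _; rewrite mulrA.
Qed.

Lemma in_idealMr gs p q : in_ideal gs p -> in_ideal gs (p * q).
Proof. by rewrite mulrC; apply: in_idealMl. Qed.

Lemma in_idealN gs p : in_ideal gs p -> in_ideal gs (- p).
Proof. by rewrite -mulN1r; apply: in_idealMl. Qed.

Lemma in_idealB gs p q : in_ideal gs p -> in_ideal gs q -> in_ideal gs (p - q).
Proof. by move=> Ip /in_idealN; apply: in_idealD. Qed.

Lemma in_ideal_sum (I : Type) (r : seq I) (P : pred I) (F : I -> R) gs :
  (forall i, P i -> in_ideal gs (F i)) -> in_ideal gs (\sum_(i <- r | P i) F i).
Proof.
by move=> IF; apply: big_ind => //; [apply: in_ideal0 | apply: in_idealD].
Qed.

Lemma mem_in_ideal gs p : p \in gs -> in_ideal gs p.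
Proof.
move=> gs_p; have lt_p : (index p gs < size gs)%N by rewrite index_mem.
exists (fun i => (i == Ordinal lt_p)%:R).
rewrite (bigD1 (Ordinal lt_p)) //= eqxx mul1r nth_index // big1 ?addr0 // => i.
by move/negPf->; rewrite mul0r.
Qed.

Lemma in_ideal_ind (P : R -> Prop) gs :
  P 0 -> (forall p q, P p -> P q -> P (p + q)) ->
  (forall c g, g \in gs -> P (c * g)) -> forall p, in_ideal gs p -> P p.
Proof.
move=> P0 PD PM p [c ->]; apply: big_ind => // i _.
by apply: PM; apply: mem_nth.
Qed.

Lemma in_ideal_trans gs hs p :
  (forall g, g \in gs -> in_ideal hs g) -> in_ideal gs p -> in_ideal hs p.
Proof.
move=> gs_hs; move: p; apply: in_ideal_ind => [|p q|c g /gs_hs].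
- exact: in_ideal0.
- exact: in_idealD.
- exact: in_idealMl.
Qed.

Lemma in_idealP gs p :
  in_ideal gs p <-> exists c : nat -> R, p = \sum_(i < size gs) c i * gs`_i.
Proof.
split=> [[c ->]|[c ->]]; last by exists (fun i => c i).
exists (fun k => oapp c 0 (insub k)).
by apply: eq_bigr => i _; rewrite valK.
Qed.

End Ideals.

(** An [idomainType] carries a unit predicate and an inverse function. Classical choice supplies
    both, so the carrier is unchanged and the embedding is the identity. *)
Lemma integral_ring_embeds_idomain (D : comNzRingType) :
  (forall x y : D, x * y = 0 -> (x == 0) || (y == 0)) ->
  exists (D' : idomainType) (f : {rmorphism D -> D'}), injective f.
Proof.
move=> intD.
pose invertible (x y : D) := y * x = 1.
pose unitD : pred D := fun x => boolp.asbool (exists y, invertible x y).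
pose invD (x : D) : D :=
  if boolp.pselect (exists y, invertible x y) is left ex then sval (boolp.cid ex)
  else x.
have mulVD : {in unitD, left_inverse 1 invD *%R}.
  move=> x /boolp.asboolP ex; rewrite /invD.
  by case: boolp.pselect => // ex'; apply: (svalP (boolp.cid ex')).
have unitDP (x y : D) : y * x = 1 -> unitD x.
  by move=> yx; apply/boolp.asboolP; exists y.
have invD_out : {in [predC unitD], invD =1 id}.
  move=> x /negP nUx; rewrite /invD; case: boolp.pselect => // ex.
  by case: nUx; apply/boolp.asboolP.
pose U := GRing.ComNzRing_hasMulInverse.Build D mulVD unitDP invD_out.
pose D1 : comUnitRingType := HB.pack D U.
pose D' : idomainType := HB.pack D D1 (GRing.ComUnitRing_isIntegral.Build D1 intD).
by exists D', (idfun : {rmorphism D -> D}).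
Qed.

Section PrimeExistence.
Variables (R : comNzRingType) (gs : seq R) (a : R).
Hypothesis a_pow : forall N, ~ in_ideal gs (a ^+ N).

Let avoiding (A : R -> Prop) :=
  [/\ forall p, in_ideal gs p -> A p, forall p q, A p -> A q -> A (p + q),
      forall p q, A q -> A (p * q) & forall N, ~ A (a ^+ N)].

(** Zorn's lemma: the union of a nonempty chain of avoiding ideals is avoiding, and [in_ideal gs]
    bounds the empty chain. *)
Lemma maximal_avoiding_ideal :
  exists2 A, avoiding A &
    forall B, avoiding B -> (forall p, A p -> B p) -> forall p, B p -> A p.
Proof.
pose T := {A : R -> Prop | avoiding A}.
pose r (A B : T) := boolp.asbool (forall p, sval A p -> sval B p).
have av0 : avoiding (in_ideal gs).
  by split=> // [p q|p q]; [apply: in_idealD | apply: in_idealMl].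
have [A B C AB BC|F totF|[A avA] maxA] :=
    @classical_sets.ZL_preorder T (exist _ _ av0) r (fun A => boolp.asboolT (fun _ => id)).
- apply/boolp.asboolP => p Ap; move/boolp.asboolP: BC; apply.
  by move/boolp.asboolP: AB; apply.
- have [[A0 FA0]|noF] := boolp.pselect (exists A, F A); last first.
    by exists (exist _ _ av0) => A FA; case: noF; exists A.
  have avU : avoiding (fun p => exists2 A : T, F A & sval A p).
    split=> [p Ip|p q [A FA Ap] [B FB Bq]|p q [A FA Aq]|N [A FA]].
    + by exists A0 => //; case: (svalP A0) => + _ _ _; apply.
    + have [/boolp.asboolP AB|/boolp.asboolP BA] := totF A B FA FB.
        exists B => //; case: (svalP B) => _ + _ _; apply=> //; exact: AB.
      exists A => //; case: (svalP A) => _ + _ _; apply=> //; exact: BA.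
    + by exists A => //; case: (svalP A) => _ _ + _; apply.
    + by case: (svalP A) => _ _ _; apply.
  by exists (exist _ _ avU) => A FA; apply/boolp.asboolP => p Ap; exists A.
exists A => // B avB AB p Bp.
have /boolp.asboolP/(_ p) := maxA (exist _ B avB) (boolp.asboolT AB).
exact.
Qed.

(** An ideal A maximal among those avoiding the powers of a is prime: if u and v are outside A, then
    A + (u) and A + (v) contain powers of a, whose product lies in A + (uv). *)
Lemma prime_avoiding :
  exists Q : prime_idealr R,
    (forall p, in_ideal gs p -> p \in (Q : {pred R})) /\ a \notin (Q : {pred R}).
Proof.
have [A [gsA AD AM Aa] maxA] := maximal_avoiding_ideal.
have A0 : A 0 by apply/gsA/in_ideal0.
pose Q : R -> bool := fun p => boolp.asbool (A p).
have QP p : reflect (A p) (p \in Q) by apply: boolp.asboolP.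
have idQ : idealr_closed Q.
  split; first exact/QP.
    by apply/negP => /QP A1; apply: (Aa 0); rewrite expr0.
  by move=> x u v /QP Au /QP Av; apply/QP/AD => //; apply: AM.
have adjoin u : ~ A u -> exists N c, A (a ^+ N - c * u).
  move=> nAu; apply: boolp.contrapT => no.
  apply/nAu/(maxA (fun p => exists c, A (p - c * u))).
  - split=> [p /gsA Ap|p q [c Ap] [c' Aq]|p q [c Aq]|N [c Ac]].
    + by exists 0; rewrite mul0r subr0.
    + exists (c + c'); rewrite mulrDl opprD addrACA; exact: AD.
    + exists (p * c); rewrite -mulrA -mulrBr; exact: AM.
    + by apply: no; exists N, c.
  - by move=> p Ap; exists 0; rewrite mul0r subr0.
  - by exists 1; rewrite mul1r subrr.
have prQ : prime_idealr_closed Q.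
  move=> u v /QP Auv; apply/orP; apply: boolp.contrapT => nuv.
  have [|N [c Ac]] := adjoin u; first by move=> /QP Qu; apply: nuv; left.
  have [|N' [c' Ac']] := adjoin v; first by move=> /QP Qv; apply: nuv; right.
  apply: (Aa (N + N')%N); rewrite exprD.
  have -> : a ^+ N * a ^+ N' =
      a ^+ N' * (a ^+ N - c * u) + (c * u) * (a ^+ N' - c' * v) + c * c' * (u * v).
    rewrite !mulrBr [in X in X - _]mulrC [a ^+ N' * (c * u)]mulrC.
    by rewrite addrA subrK mulrACA subrK.
  by apply: (AD); [apply: (AD)|]; apply: (AM).
pose Qb := HB.pack_for (prime_idealr R) Q (isIdealr.Build R Q idQ)
  (isPrimeIdealrClosed.Build R Q prQ).
exists Qb; split=> [p /gsA Ap|]; first exact/QP.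
by apply/negP => /QP; rewrite -[a]expr1; apply: Aa.
Qed.

Lemma domain_avoiding :
  exists (D : idomainType) (f : {rmorphism R -> D}),
    (forall p, in_ideal gs p -> f p = 0) /\ f a != 0.
Proof.
have [Q [gsQ aQ]] := prime_avoiding.
have piE (p : R) : (\pi_({ideal_quot Q})%qT p == 0) = (p \in (Q : {pred R})).
  by rewrite -(rmorph0 (\pi_({ideal_quot Q})%qT)) -Quotient.idealrBE subr0.
have [D [f f_inj]] := integral_ring_embeds_idomain (@Quotient.rquot_IdomainAxiom R Q).
exists D, (f \o \pi_({ideal_quot Q})%qT).
by split=> [p /gsQ Qp|]; [apply/eqP|]; rewrite /= -(rmorph0 f) (inj_eq f_inj) piE.
Qed.

End PrimeExistence.

Section KernelPrime.
Variables (R : nzRingType) (D : idomainType) (f : {rmorphism R -> D}).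

(** The primes in the height computations arise as kernels of substitutions. *)
Lemma kernel_prime : exists Q : prime_idealr R,
  forall p, (p \in (Q : {pred R})) = (f p == 0).
Proof.
pose Q : R -> bool := fun p => f p == 0.
have QE p : (p \in Q) = (f p == 0) by [].
have idQ : idealr_closed Q.
  split; rewrite ?QE ?rmorph0 ?rmorph1 ?oner_eq0 //.
  move=> a u v; rewrite !QE => /eqP fu /eqP fv.
  by rewrite rmorphD rmorphM fu fv mulr0 addr0.
have prQ : prime_idealr_closed Q.
  by move=> u v; rewrite !QE rmorphM mulf_eq0.
by exists (HB.pack_for (prime_idealr R) Q (isIdealr.Build R Q idQ)
  (isPrimeIdealrClosed.Build R Q prQ)).
Qed.

End KernelPrime.

(** * Algebraic dependence *)

Lemma wide_kernel (K : fieldType) (p q : nat) (M : 'M[K]_(p, q)) :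
  (q < p)%N -> exists2 v : 'rV[K]_p, v != 0 & v *m M = 0.
Proof.
move=> lt_qp; have : kermx M != 0.
  rewrite kermx_eq0 /row_free; apply: contraTneq lt_qp => <-.
  by rewrite -leqNgt rank_leq_col.
by case/rowV0Pn => v /sub_kermxP vM v0; exists v.
Qed.

Lemma msizeM_bound (K : fieldType) (n k l : nat) (p q : {mpoly K[n]}) :
  (msize p <= k.+1)%N -> (msize q <= l.+1)%N -> (msize (p * q) <= (k + l).+1)%N.
Proof.
have [-> _ _|p0 pk] := eqVneq p 0; first by rewrite mul0r msize0.
have [-> _|q0 ql] := eqVneq q 0; first by rewrite mulr0 msize0.
rewrite msizeM // -ltnS prednK; last by rewrite addn_gt0 lt0n msize_poly_eq0 p0.
by rewrite -addnS -addSn leq_add.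
Qed.

Lemma msizeX_bound (K : fieldType) (n k l : nat) (p : {mpoly K[n]}) :
  (msize p <= k.+1)%N -> (msize (p ^+ l) <= (l * k).+1)%N.
Proof.
move=> pk; elim: l => [|l IHl]; first by rewrite msize1.
by rewrite exprS mulSn msizeM_bound.
Qed.

Lemma mmap_mmap (K : fieldType) (q s : nat) (E : comNzRingType)
    (kappa : {rmorphism K -> E}) (z : 'I_q -> E) (P : 'I_s -> {mpoly K[q]})
    (F : {mpoly K[s]}) :
  mmap kappa z (mmap (@mpolyC q K) P F) =
  mmap kappa (fun i => mmap kappa z (P i)) F.
Proof.
rewrite [mmap (@mpolyC q K) P F]/mmap rmorph_sum /=; apply: eq_bigr => m _.
rewrite rmorphM /= mmapC rmorph_prod; congr (_ * _).
by apply: eq_bigr => i _; rewrite rmorphXn.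
Qed.

(** The D ^ s products of the P i with exponents below D involve only monomials with exponents below
    B, of which there are B ^ q. Since q < s, a large D leaves more products than monomials, and a
    kernel vector of the coefficient matrix is a relation. *)
Lemma mpoly_family_dependent (K : fieldType) (q s : nat) (P : 'I_s -> {mpoly K[q]}) :
  (q < s)%N -> exists2 F : {mpoly K[s]}, F != 0 & mmap (@mpolyC q K) P F = 0.
Proof.
move=> lt_qs; pose e := (\max_(i < s) msize (P i))%N.
(* With this choice B <= D * (s * e).+1, whence B ^ q <= D ^ q * (s * e).+1 ^ q < D ^ q.+1 <= D ^
   s. *)
pose D := ((s * e).+1 ^ q).+1.
pose mon (a : {ffun 'I_s -> 'I_D}) : 'X_{1..s} := [multinom (a i : nat) | i < s].
have mon_inj : injective mon.
  move=> a b /mnmP ab; apply/ffunP => i; apply: val_inj.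
  by have := ab i; rewrite !mnmE.
pose B := (s * (D * e)).+1.
pose mon' (b : {ffun 'I_q -> 'I_B}) : 'X_{1..q} := [multinom (b i : nat) | i < q].
pose PP (a : {ffun 'I_s -> 'I_D}) := mmap1 P (mon a).
have szPP a : (msize (PP a) <= B)%N.
  suff: (msize (PP a) <= (\sum_(i < s) D * e).+1)%N.
    by rewrite sum_nat_const card_ord.
  rewrite /PP /mmap1.
  apply: (big_ind2 (fun p k => msize p <= k.+1)%N) => [|p k p' k'|i _].
  - by rewrite msize1.
  - exact: msizeM_bound.
  rewrite mnmE; apply: (@leq_trans (a i * e).+1); last first.
    by rewrite ltnS leq_mul2r ltnW ?orbT.
  by apply: msizeX_bound; rewrite leqW // leq_bigmax.
pose M := \matrix_(i < #|{: {ffun 'I_s -> 'I_D}}|, j < #|{: {ffun 'I_q -> 'I_B}}|)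
  (PP (enum_val i))@_(mon' (enum_val j)).
have [|v v0 vM] := @wide_kernel K _ _ M.
  rewrite !card_ffun !card_ord.
  have le_B : (B <= D * (s * e).+1)%N.
    rewrite /B mulnS mulnCA addnC -addn1 leq_add2l; exact: isT.
  apply: (@leq_ltn_trans (D ^ q * (s * e).+1 ^ q)).
    by rewrite -expnMn; case: (q) => // k; rewrite leq_exp2r.
  apply: (@leq_trans (D ^ q.+1)); last by rewrite leq_pexp2l.
  by rewrite expnSr ltn_pmul2l ?expn_gt0.
exists (\sum_i v 0 i *: 'X_[mon (enum_val i)]).
  apply: contraNneq v0 => F0; apply/eqP/rowP => i; rewrite mxE.
  have := congr1 (mcoeff (mon (enum_val i))) F0.
  rewrite mcoeff0 raddf_sum /= (bigD1 i) //= mcoeffZ mcoeffX eqxx mulr1.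
  rewrite big1 ?addr0 // => j ji; rewrite mcoeffZ mcoeffX.
  by rewrite (inj_eq mon_inj) (inj_eq enum_val_inj) (negPf ji) mulr0.
rewrite (raddf_sum (mmap (@mpolyC q K) P)).
apply/mpolyP => m; rewrite mcoeff0 raddf_sum /=.
have coefE i : (mmap (@mpolyC q K) P (v 0 i *: 'X_[mon (enum_val i)]))@_m =
    v 0 i * (PP (enum_val i))@_m.
  by rewrite mmapZ mmapX mcoeffCM.
under eq_bigr => i _ do rewrite coefE.
have [lt_mB|ge_mB] := ltnP (mdeg m) B; last first.
  rewrite big1 // => i _; rewrite memN_msupp_eq0 ?mulr0 //.
  by apply: msize_mdeg_ge; apply: leq_trans ge_mB.
have lt_mi i : (m i < B)%N.
  by apply: leq_ltn_trans lt_mB; rewrite mdegE (bigD1 i) //= leq_addr.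
pose b : {ffun 'I_q -> 'I_B} := [ffun i => Ordinal (lt_mi i)].
have -> : m = mon' b by apply/mnmP => i; rewrite mnmE ffunE.
have := congr1 (fun r : 'rV__ => r 0 (enum_rank b)) vM; rewrite !mxE => vMb.
rewrite -[RHS]vMb.
by apply: eq_bigr => i _; rewrite !mxE enum_rankK.
Qed.

(** A relation among polynomials P i with y i = P i (z) survives the substitution of z. *)
Lemma algebraically_dependent (K : fieldType) (q s : nat) (E : comNzRingType)
    (kappa : {rmorphism K -> E}) (z : 'I_q -> E) (y : 'I_s -> E) :
  (q < s)%N -> (forall i, exists P, y i = mmap kappa z P) ->
  exists2 F : {mpoly K[s]}, F != 0 & mmap kappa y F = 0.
Proof.
move=> lt_qs /boolp.choice[P yP].
have [F F0 FP] := mpoly_family_dependent P lt_qs; exists F => //.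
have -> : y = fun i => mmap kappa z (P i) by apply: boolp.funext.
by rewrite -mmap_mmap FP mmap0.
Qed.

(** * Polynomials over an infinite field *)

Lemma uniq_seq_exists (T : eqType) :
  (forall s : seq T, exists x, x \notin s) ->
  forall N, exists2 s : seq T, uniq s & size s = N.
Proof.
move=> T_infinite; elim=> [|N [s s_uniq sN]]; first by exists [::].
by have [x xs] := T_infinite s; exists (x :: s); rewrite /= ?xs ?sN.
Qed.

Lemma infinite_codomain (T U : eqType) (g : T -> U) :
  (forall s : seq T, exists x, x \notin s) -> injective g ->
  forall s : seq U, exists x, x \notin s.
Proof.
move=> T_infinite g_inj s; have [r r_uniq r_size] := uniq_seq_exists T_infinite (size s).+1.
apply: boolp.contrapT => all_s.
have sub : {subset map g r <= s}.
  by move=> x _; apply: contra_notT all_s => xs; exists x.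
have := uniq_leq_size _ sub; rewrite map_inj_uniq // size_map r_size ltnn.
by move/(_ r_uniq).
Qed.

(* The variables are specialized one at a time, avoiding each time the
   finitely many roots of a polynomial over a domain. *)
Lemma mpoly_nonvanishing (K : fieldType)
    (K_infinite : forall s : seq K, exists x, x \notin s)
    (n : nat) (F : {mpoly K[n]}) : F != 0 -> exists v : 'I_n -> K, F.@[v] != 0.
Proof.
move=> F0; pose sub k (v : 'I_n -> K) (i : 'I_n) : {mpoly K[n]} :=
  if (i < k)%N then (v i)%:MP else 'X_i.
have: forall k, exists v, mmap (@mpolyC n K) (sub k v) F != 0.
  elim=> [|k [v Fv]].
    exists (fun=> 0); rewrite (_ : mmap _ _ F = F) // [RHS]mpolyE /mmap.
    apply: eq_bigr => m _; by rewrite mul_mpolyC mpolyXE_id.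
  have [le_nk|lt_kn] := leqP n k.
    exists v; rewrite (_ : sub k.+1 v = sub k v) //; apply: boolp.funext => i.
    by rewrite /sub ltnS (leq_trans (ltnW (ltn_ord i)) le_nk) (leq_trans (ltn_ord i) le_nk).
  pose j := Ordinal lt_kn.
  pose u (i : 'I_n) : {poly {mpoly K[n]}} := if i == j then 'X else (sub k v i)%:P.
  pose p := mmap (polyC \o @mpolyC n K) u F.
  have pE c : p.[c] = mmap (@mpolyC n K) (fun i => if i == j then c else sub k v i) F.
    rewrite /p /mmap horner_sum; apply: eq_bigr => m _.
    rewrite hornerM hornerC /mmap1 horner_prod; congr (_ * _).
    by apply: eq_bigr => i _; rewrite horner_exp /u; case: ifP; rewrite ?hornerX ?hornerC.
  (* At ['X_j] the polynomial p takes the value that is nonzero by induction. *)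
  have p0 : p != 0.
    apply: contraNneq Fv => p0; apply/eqP.
    rewrite -[RHS](horner0 'X_j) -p0 pE; congr mmap; apply: boolp.funext => i.
    by case: eqP => // ->; rewrite /sub ltnn.
  have [c pc] : exists c : K, ~~ root p c%:MP.
    apply: boolp.contrapT => all_roots.
    have rt c : root p c%:MP by apply: contra_notT all_roots => pc; exists c.
    have [rs rs_uniq rs_size] := uniq_seq_exists K_infinite (size p).
    have := @max_poly_roots _ p [seq c%:MP | c <- rs] p0.
    rewrite size_map rs_size ltnn => H; have //: false; apply: H.
      by apply/allP => _ /mapP[c _ ->].
    by rewrite map_inj_uniq // => x y /eqP; rewrite mpolyC_eq => /eqP.
  exists (fun i => if i == j then c else v i).
  apply: contraNneq pc => Fc; rewrite rootE pE -{}Fc; apply/eqP; congr mmap.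
  apply: boolp.funext => i; rewrite /sub ltnS [(i <= k)%N]leq_eqVlt.
  have -> : (nat_of_ord i == k) = (i == j) by [].
  by case: eqP => // _ /=.
case/(_ n) => v Fv; exists v; apply: contraNneq Fv => Fv; apply/eqP.
rewrite (_ : sub n v = fun i => (v i)%:MP); last first.
  by apply: boolp.funext => i; rewrite /sub ltn_ord.
rewrite -[RHS](mpolyC0 n K) -Fv mevalE rmorph_sum; apply: eq_bigr => m _.
rewrite rmorphM rmorph_prod; congr (_ * _).
by apply: eq_bigr => i _; rewrite rmorphXn.
Qed.

(** * The dimension of polynomial rings *)

Lemma prime_expr (R : comNzRingType) (Q : prime_idealr R) (a : R) e :
  a \notin (Q : {pred R}) -> a ^+ e \notin (Q : {pred R}).
Proof.
move=> aQ; elim: e => [|e IHe]; first by rewrite expr0 idealr1.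
by rewrite exprS prime_idealrM negb_or aQ.
Qed.

(* Given a relation F among elements a_i of P_(i+1) outside P_i, repeatedly
   divide by the smallest power of a_i and reduce modulo P_(i+1): a nonzero
   constant ends up in the last prime. *)
Lemma no_long_prime_chain (K : fieldType) (n : nat)
    (P : nat -> prime_idealr {mpoly K[n]}) : ~ prime_chain n.+1 P.
Proof.
move=> chP.
have /boolp.choice[a aP] : forall i : 'I_n.+1, exists x,
    x \in (P i.+1 : {pred _}) /\ x \notin (P i : {pred _}).
  by move=> i; have [_ [x]] := chP i (ltn_ord i); exists x.
have [F F0 Fa] := mpoly_family_dependent a (ltnSn n).
pose tail k (m : 'X_{1..n.+1}) := (F@_m)%:MP * \prod_(i < n.+1 | (k <= i)%N) a i ^+ m i.
pose agree k (s : seq 'X_{1..n.+1}) :=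
  {in s &, forall m m' : 'X_{1..n.+1}, forall i : 'I_n.+1, (i < k)%N -> m i = m' i}.
(* Invariant: the monomials of s agree in their first k exponents, and their terms, stripped of the
   first k factors, sum to an element of P k. *)
have step k : (k <= n.+1)%N -> exists s : seq 'X_{1..n.+1},
    [/\ s != [::], uniq s, {subset s <= msupp F}, agree k s & \sum_(m <- s) tail k m \in (P k : {pred _})].
  elim: k => [_|k IHk lt_k].
    exists (msupp F); split=> //; rewrite ?msupp_eq0 //.
    suff -> : \sum_(m <- msupp F) tail 0 m = 0 by apply: idealr0.
    by rewrite -[RHS]Fa.
  have [s [s0 Us sF ags Ps]] := IHk (ltnW lt_k).
  pose j := Ordinal lt_k; have [Pj nPj] := aP j.
  have exE : exists e : nat, has (fun m : 'X_{1..n.+1} => m j == e) s.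
    by case: (s) s0 => // m s' _; exists (m j); rewrite /= eqxx.
  case: (ex_minnP exE) => e /hasP[m0 sm0 /eqP m0e] min_e.
  have le_e (m : 'X_{1..n.+1}) : m \in s -> (e <= m j)%N.
    by move=> sm; apply: min_e; apply/hasP; exists m.
  exists (filter (fun m : 'X_{1..n.+1} => m j == e) s); split.
  - by apply/eqP => s'0; have: m0 \in [::] by rewrite -s'0 mem_filter m0e eqxx.
  - exact: filter_uniq.
  - by move=> m; rewrite mem_filter => /andP[_ /sF].
  - move=> m m'; rewrite !mem_filter => /andP[/eqP mj sm] /andP[/eqP m'j sm'] i.
    rewrite ltnS leq_eqVlt => /orP[ik|]; last exact: ags.
    by have -> : i = j by [apply/val_inj/eqP]; rewrite mj.
  have tailE (m : 'X_{1..n.+1}) : m \in s -> tail k m = a j ^+ e * (a j ^+ (m j - e) * tail k.+1 m).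
    move=> sm; rewrite mulrA -exprD subnKC ?le_e // /tail (bigD1 j) //= mulrCA.
    congr (_ * (_ * _)); apply: eq_bigl => i.
    by rewrite ltn_neqAle andbC eq_sym.
  have {Ps} : \sum_(m <- s) a j ^+ (m j - e) * tail k.+1 m \in (P k : {pred _}).
    move: Ps; rewrite big_seq (eq_bigr _ tailE) -big_seq -mulr_sumr prime_idealrM.
    by rewrite (negPf (prime_expr _ nPj)).
  move/(chP k lt_k).1; rewrite (bigID (fun m : 'X_{1..n.+1} => m j == e)) /=.
  rewrite addrC rpredDl; last first.
    rewrite big_seq_cond; apply: rpred_sum => m /andP[sm mj].
    have : (0 < m j - e)%N by rewrite subn_gt0 ltn_neqAle eq_sym mj le_e.
    case: (m j - e)%N => // x _; rewrite exprS mulrAC mulrC.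
    by rewrite idealMr // mulrC idealMr.
  rewrite big_filter (eq_bigr (tail k.+1)) // => m /eqP->.
  by rewrite subnn mul1r.
(* All exponents are now fixed, so a single monomial is left and its tail is its nonzero
   coefficient. *)
have [s [s0 Us sF ags Ps]] := step n.+1 (leqnn _).
have [m0 sm0] : exists m, m \in s by case: (s) s0 => // m s' _; exists m; rewrite mem_head.
have s1 : s =i [:: m0].
  move=> m; rewrite inE; apply/idP/eqP => [sm|-> //].
  by apply/mnmP => i; apply: ags.
have sE := perm_big _ (uniq_perm Us (isT : uniq [:: m0]) s1).
move: Ps; rewrite sE big_seq1 /tail big1 ?mulr1; last first.
  by move=> i; rewrite leqNgt ltn_ord.
move=> Pc; have: (F@_m0)^-1%:MP * (F@_m0)%:MP \in (P n.+1 : {pred _}) by apply: idealMr.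
rewrite -mpolyCM mulVf ?mpolyC1 ?idealr1 //.
by rewrite -mcoeff_msupp sF.
Qed.

(** * Forms with a power of the maximal ideal in their ideal *)

(* The Koszul complex on gs: a chain is a function on bit lists of length size
   gs, a bit list standing for the exterior product of the basis vectors it
   selects. koszul_wedge cs is the exterior product by the vector with
   coordinates cs. *)
Section Koszul.
Variable R : comNzRingType.
Implicit Types (gs cs : seq R) (w : seq bool -> R) (s : seq bool).

(** Sign convention: d(e /\ w) = g w - e /\ dw for the first basis vector e. *)
Fixpoint koszul_diff gs w s : R :=
  match gs, s with
  | g :: gs', b :: s' =>
      if b then - koszul_diff gs' (fun t => w (true :: t)) s'
      else g * w (true :: s') + koszul_diff gs' (fun t => w (false :: t)) s'
  | _, _ => 0
  end.

Fixpoint koszul_wedge cs w s : R :=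
  match cs, s with
  | c :: cs', b :: s' =>
      if b then c * w (false :: s') - koszul_wedge cs' (fun t => w (true :: t)) s'
      else koszul_wedge cs' (fun t => w (false :: t)) s'
  | _, _ => 0
  end.

Definition dotp cs gs : R := \sum_(i < size gs) cs`_i * gs`_i.

Lemma dotp_cons c cs g gs : dotp (c :: cs) (g :: gs) = c * g + dotp cs gs.
Proof. by rewrite /dotp /= big_ord_recl. Qed.

Lemma koszul_diffN gs w s :
  koszul_diff gs (fun t => - w t) s = - koszul_diff gs w s.
Proof.
elim: gs w s => [|g gs IHg] w [|[] s] /=; rewrite ?oppr0 //; first by rewrite IHg.
by rewrite IHg mulrN opprD.
Qed.

Lemma koszul_diffD gs a w w' s :
  koszul_diff gs (fun t => a * w t + w' t) s =
  a * koszul_diff gs w s + koszul_diff gs w' s.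
Proof.
elim: gs w w' s => [|g gs IHg] w w' [|[] s] /=; rewrite ?mulr0 ?addr0 //.
  by rewrite IHg; ring.
by rewrite IHg; ring.
Qed.

Lemma koszul_wedgeN cs w s :
  koszul_wedge cs (fun t => - w t) s = - koszul_wedge cs w s.
Proof.
elim: cs w s => [|c cs IHc] w [|[] s] /=; rewrite ?oppr0 //.
by rewrite IHc; ring.
Qed.

Lemma koszul_wedgeD cs a w w' s :
  koszul_wedge cs (fun t => a * w t + w' t) s =
  a * koszul_wedge cs w s + koszul_wedge cs w' s.
Proof.
elim: cs w w' s => [|c cs IHc] w w' [|[] s] /=; rewrite ?mulr0 ?addr0 //.
by rewrite IHc; ring.
Qed.

Lemma eq_koszul_diff gs w w' s : (forall t, size t = size s -> w t = w' t) ->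
  koszul_diff gs w s = koszul_diff gs w' s.
Proof.
elim: gs w w' s => [|g gs IHg] w w' [|[] s] //= ww'.
  by congr (- _); apply: IHg => t ts; apply: ww'; rewrite /= ts.
rewrite (ww' (true :: s)) //; congr (_ + _).
by apply: IHg => t ts; apply: ww'; rewrite /= ts.
Qed.

Lemma koszul_diff_diff gs w s : koszul_diff gs (koszul_diff gs w) s = 0.
Proof.
elim: gs w s => [|g gs IHg] w [|[] s] //=.
  by rewrite koszul_diffN opprK IHg.
by rewrite koszul_diffD IHg; ring.
Qed.

(** Contraction is an antiderivation: moving d across c gives the scalar product of c and gs, and
    the remaining terms cancel. *)
Lemma koszul_homotopy gs cs w s : size cs = size gs -> size s = size gs ->
  koszul_diff gs (koszul_wedge cs w) s + koszul_wedge cs (koszul_diff gs w) s =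
  dotp cs gs * w s.
Proof.
elim: gs cs w s => [|g gs IHg] [|c cs] w [|b s] //=.
  by rewrite /dotp big_ord0 mul0r addr0.
move=> [size_cs] [size_s]; rewrite dotp_cons.
have homotopy w' := IHg cs w' s size_cs size_s; case: b.
  rewrite koszul_diffD koszul_diffN koszul_wedgeN.
  by rewrite [RHS]mulrDl -(homotopy (fun t => w (true :: t))); ring.
by rewrite koszul_wedgeD [RHS]mulrDl -(homotopy (fun t => w (false :: t))); ring.
Qed.

Lemma koszul_wedge_closed (P : R -> Prop) cs w s :
  P 0 -> (forall x y, P x -> P y -> P (x - y)) -> (forall x y, P y -> P (x * y)) ->
  (forall t, size t = size s -> P (w t)) -> P (koszul_wedge cs w s).
Proof.
move=> P0 PB PM; elim: cs w s => [|c cs IHc] w [|[] s] //= Pw.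
  by apply: PB; [apply/PM/Pw | apply: IHc => t ts; apply: Pw; rewrite /= ts].
by apply: IHc => t ts; apply: Pw; rewrite /= ts.
Qed.

Lemma koszul_diff_closed (P : R -> Prop) gs w s :
  P 0 -> (forall x y, P x -> P y -> P (x - y)) -> (forall x y, P y -> P (x * y)) ->
  (forall t, size t = size s -> P (w t)) -> P (koszul_diff gs w s).
Proof.
move=> P0 PB PM; have PN x : P x -> P (- x) by rewrite -sub0r; apply: PB.
have PD x y : P x -> P y -> P (x + y) by rewrite -[y in x + y]opprK => ? /PN; apply: PB.
elim: gs w s => [|c cs IHc] w [|[] s] //= Pw.
  by apply: PN; apply: IHc => t ts; apply: Pw; rewrite /= ts.
by apply: PD; [apply/PM/Pw | apply: IHc => t ts; apply: Pw; rewrite /= ts].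
Qed.

Lemma koszul_diff_in_ideal gs w s : in_ideal gs (koszul_diff gs w s).
Proof.
elim: gs w s => [|g gs IHg] w [|b s] /=; do ?exact: in_ideal0.
have tail_in p : in_ideal gs p -> in_ideal (g :: gs) p.
  by apply: in_ideal_trans => h gs_h; apply: mem_in_ideal; rewrite inE gs_h orbT.
case: b; first by apply/in_idealN/tail_in/IHg.
apply: in_idealD; last exact/tail_in/IHg.
by rewrite mulrC; apply/in_idealMl/mem_in_ideal/mem_head.
Qed.

(* [J k] plays the role of the ideal generated by the first k elements of the
   regular sequence y. *)
Variables (gs : seq R) (N : nat) (y : nat -> R) (cs : nat -> seq R).
Variable J : nat -> R -> Prop.
Hypothesis size_cs : forall k, size (cs k) = size gs.
Hypothesis yE : forall k, (k < N)%N -> y k = dotp (cs k) gs.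
Hypothesis J0 : forall k, J k 0.
Hypothesis JB : forall k p q, J k p -> J k q -> J k (p - q).
Hypothesis JM : forall k p q, J k q -> J k (p * q).
Hypothesis J_nil : forall p, J 0 p -> p = 0.
Hypothesis J_cons : forall k, (k < N)%N ->
  forall p, J k.+1 p <-> exists a b, p = y k * a + b /\ J k b.
Hypothesis J_regular : forall k, (k < N)%N -> forall p, J k (y k * p) -> J k p.

(** The chain u c_(k-1) /\ ... /\ c_0, which is up to sign the image of u times the top basis vector
    under the comparison of the Koszul complexes of y_0, ..., y_(k-1) and of gs. For k = 0 it is u
    on the empty product, the all-false list. *)
Fixpoint wedge_chain (u : R) k : seq bool -> R :=
  if k is k'.+1 then koszul_wedge (cs k') (wedge_chain u k')
  else fun s => if has id s then 0 else u.

(** Induction by the homotopy: d(c_k /\ w) = y_k w - c_k /\ dw, where dw has coefficients in J k. *)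
Lemma koszul_diff_wedge_chain u k s : (k <= N)%N -> size s = size gs ->
  J k (koszul_diff gs (wedge_chain u k) s).
Proof.
elim: k s => [|k IHk] s le_kN ss /=.
  suff -> : koszul_diff gs (fun s => if has id s then 0 else u) s = 0 by [].
  elim: (gs) {ss} s => [|g gs' IHg] [|[] s] //=; last by rewrite IHg mulr0 addr0.
  by rewrite (_ : koszul_diff _ _ _ = 0) ?oppr0 //; elim: (gs') s {IHg}
     => [|g' gs'' IHg] [|[] s] //=; rewrite IHg ?oppr0 // mulr0 addr0.
apply/J_cons => //; exists (wedge_chain u k s).
exists (0 - koszul_wedge (cs k) (koszul_diff gs (wedge_chain u k)) s); split.
  by rewrite yE // -koszul_homotopy //; ring.
apply: JB => //; apply: koszul_wedge_closed => [|x z|x z|t ts] //.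
- exact: JB.
- exact: JM.
- by apply: IHk; rewrite ?ts // ltnW.
Qed.

(** Descending from l = N, the chain at l is a boundary modulo J l. If the chain at l + 1 is dw +
    y_l a + b with b in J l, applying d and the homotopy puts y_l times (chain at l minus da) in J
    l, and regularity cancels y_l. At l = 0 this makes u a value of the differential. *)
Lemma regular_sequence_descent u :
  (forall s, size s = size gs -> J N (wedge_chain u N s)) -> in_ideal gs u.
Proof.
move=> JN.
have descent k : (k <= N)%N -> exists w, forall s, size s = size gs ->
    J (N - k)%N (wedge_chain u (N - k)%N s - koszul_diff gs w s).
  elim: k => [_|k IHk lt_kN].
    exists (fun=> 0) => s ss; rewrite subn0; apply: JB; first exact: JN.
    by apply: koszul_diff_closed => // x z; [apply: JB | apply: JM].
  have [w] := IHk (ltnW lt_kN); rewrite -subnSK //.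
  set l := (N - k.+1)%N => Jw; have lt_lN : (l < N)%N by rewrite /l subnSK // leq_subr.
  have /boolp.choice[ab abP] : forall s, exists ab : R * R, size s = size gs ->
      wedge_chain u l.+1 s - koszul_diff gs w s = y l * ab.1 + ab.2 /\ J l ab.2.
    move=> s; have [ss|nss] := eqVneq (size s) (size gs); last first.
      by exists (0, 0) => ss; rewrite ss eqxx in nss.
    have /(J_cons lt_lN)[a [b ?]] := Jw s ss.
    by exists (a, b).
  exists (fun s => (ab s).1) => s ss; apply: J_regular => //.
  have dU : koszul_diff gs (wedge_chain u l.+1) s =
      y l * koszul_diff gs (fun t => (ab t).1) s + koszul_diff gs (fun t => (ab t).2) s.
    rewrite -koszul_diffD -[LHS]subr0 -(koszul_diff_diff gs w s) -koszul_diffN.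
    rewrite addrC -[LHS]mul1r.
    transitivity (koszul_diff gs (fun t => 1 * wedge_chain u l.+1 t + - koszul_diff gs w t) s).
      by rewrite koszul_diffD mul1r mul1r addrC.
    by apply: eq_koszul_diff => t ts; rewrite mul1r (abP t _).1 // ts.
  have : y l * (wedge_chain u l s - koszul_diff gs (fun t => (ab t).1) s) =
      koszul_wedge (cs l) (koszul_diff gs (wedge_chain u l)) s
      - (0 - koszul_diff gs (fun t => (ab t).2) s).
    have := koszul_homotopy (wedge_chain u l) (size_cs l) ss.
    rewrite -yE // [koszul_diff gs (koszul_wedge _ _) s]dU => yU.
    by rewrite mulrBr -yU; ring.
  move=> ->; apply: JB.
    apply: koszul_wedge_closed => [|x z|x z|t ts] //; [exact: JB|exact: JM|].
    by apply: koszul_diff_wedge_chain; rewrite ?ts // ltnW.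
  apply: JB => //; apply: koszul_diff_closed => [|x z|x z|t ts] //; [exact: JB|exact: JM|].
  by have [] := abP t (etrans ts ss).
have [w] := descent N (leqnn N); rewrite subnn => Jw.
pose s0 := nseq (size gs) false.
have /J_nil/subr0_eq : J 0 (wedge_chain u 0 s0 - koszul_diff gs w s0).
  by apply: Jw; rewrite size_nseq.
by rewrite /= has_nseq andbF => ->; apply: koszul_diff_in_ideal.
Qed.

End Koszul.

(** * Ideals generated by powers of variables *)

Section PowerIdeals.
Variables (K : fieldType) (n N : nat).
Implicit Types p q : {mpoly K[n]}.

(* The ideal generated by the N-th powers of the first k variables. *)
Definition power_ideal k p : bool :=
  all (fun m : 'X_{1..n} => [exists i : 'I_n, (i < k)%N && (N <= m i)%N]) (msupp p).

Lemma power_idealP k p :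
  reflect (forall m, m \in msupp p -> exists2 i : 'I_n, (i < k)%N & (N <= m i)%N)
          (power_ideal k p).
Proof.
apply: (iffP allP) => Jp m /Jp; first by case/existsP => i /andP[]; exists i.
by case=> i ik Nm; apply/existsP; exists i; rewrite ik.
Qed.

Lemma power_ideal0 k : power_ideal k 0.
Proof. by rewrite /power_ideal msupp0. Qed.

Lemma power_idealB k p q : power_ideal k p -> power_ideal k q -> power_ideal k (p - q).
Proof.
move=> /power_idealP Jp /power_idealP Jq; apply/power_idealP => m /msuppB_le.
by rewrite mem_cat => /orP[/Jp|/Jq].
Qed.

Lemma power_idealM k p q : power_ideal k q -> power_ideal k (p * q).
Proof.
move=> /power_idealP Jq; apply/power_idealP => m /msuppM_le/allpairsP[[m1 m2] /=].
case=> _ /Jq[i ik Nm] ->; exists i => //.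
by rewrite mnmDE (leq_trans Nm) ?leq_addl.
Qed.

Lemma power_ideal_nil p : power_ideal 0 p -> p = 0.
Proof.
move=> /power_idealP Jp; apply: msuppnil0; case: (msupp p) Jp => // m s Jp.
by have [] := Jp m (mem_head _ _).
Qed.

(** Multiplication by X_k ^ N changes only the exponent of X_k, while membership depends on the
    exponents of the earlier variables. *)
Lemma power_idealX_cancel (k : 'I_n) p : power_ideal k ('X_k ^+ N * p) -> power_ideal k p.
Proof.
move=> /power_idealP Jp; apply/power_idealP => m pm.
have [|i ik] := Jp (m + U_(k) *+ N)%MM.
  by rewrite mcoeff_msupp mpolyXn mulrC addmC mcoeffMX -mcoeff_msupp.
rewrite mnmDE mulmnE mnm1E; have [ki|] := eqVneq; last by rewrite addn0; exists i.
by move: ik; rewrite -ki ltnn.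
Qed.

Lemma power_ideal_cons (k : 'I_n) p :
  power_ideal k.+1 p <-> exists a b, p = 'X_k ^+ N * a + b /\ power_ideal k b.
Proof.
split=> [/power_idealP Jp|[a [b [-> Jb]]]]; last first.
  apply/power_idealP => m /msuppD_le; rewrite mem_cat => /orP[|pm]; last first.
    by have [i ik Nm] := power_idealP _ _ Jb m pm; exists i => //; rewrite ltnW.
  move=> /msuppM_le/allpairsP[[m1 m2] /= [+ _ ->]].
  rewrite mpolyXn msuppX inE => /eqP->; exists k => //.
  by rewrite mnmDE mulmnE mnm1E eqxx mul1n leq_addr.
(* The terms outside the ideal of the earlier powers are divisible by X_k ^ N. *)
pose low (m : 'X_{1..n}) := [exists i : 'I_n, (i < k)%N && (N <= m i)%N].
exists (\sum_(m <- msupp p | ~~ low m) p@_m *: 'X_[m - U_(k) *+ N]).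
exists (\sum_(m <- msupp p | low m) p@_m *: 'X_[m]); split.
  rewrite [LHS]mpolyE (bigID low) /= addrC; congr (_ + _).
  rewrite mulr_sumr big_seq_cond [RHS]big_seq_cond; apply: eq_bigr => m /andP[pm].
  rewrite /low negb_exists => /forallP nlow.
  rewrite -scalerAr mpolyXn -mpolyXD addmC submK //; apply/mnm_lepP => i.
  rewrite mulmnE mnm1E; have [<-|_] := eqVneq; last by rewrite mul0n.
  have [i' + Nm] := Jp m pm; rewrite mul1n ltnS leq_eqVlt => /orP[/eqP/val_inj <- //|i'k].
  by have := nlow i'; rewrite i'k Nm.
apply/power_idealP => m /msupp_sum_le/flattenP[s /mapP[m']].
rewrite mem_filter => /andP[lm' _] -> /msuppZ_le; rewrite msuppX inE => /eqP->.
by case/existsP: lm' => i /andP[]; exists i.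
Qed.

(** Pigeonhole: n exponents below N add up to at most n (N - 1). *)
Lemma power_ideal_homog d p :
  p \is d.-homog -> (n * (N - 1) < d)%N -> power_ideal n p.
Proof.
move=> /dhomogP pd lt_d; apply/power_idealP => m /pd md.
have [i Ni|small] := pickP (fun i : 'I_n => N <= m i)%N; first by exists i.
move: lt_d; rewrite -md /= mdegE ltnNge => /negP[].
have -> : (n * (N - 1) = \sum_(i < n) (N - 1))%N by rewrite sum_nat_const card_ord.
by apply: leq_sum => i _; have := small i; lia.
Qed.

End PowerIdeals.

(** * Graded components of ideals *)

Section Components.
Variables (K : fieldType) (n : nat).
Implicit Types (p c g : {mpoly K[n]}) (gs : seq {mpoly K[n]}).

Lemma pihomogM d e c g : g \is e.-homog ->
  pihomog mdeg d (c * g) = if (e <= d)%N then pihomog mdeg (d - e) c * g else 0.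
Proof.
move=> ge; rewrite {1}(pihomog_partitionE (leqnn (msize c))) mulr_suml linear_sum /=.
have term i : pihomog mdeg d (pihomog mdeg i c * g) =
    if (i + e == d)%N then pihomog mdeg i c * g else 0.
  have ie := dhomogM (pihomogP mdeg i c) ge.
  by case: eqP => [<-|/eqP ne]; [rewrite pihomog_dE | apply: pihomog_ne0 ie].
under eq_bigr => i _ do rewrite term.
case: leqP => [le_ed|lt_de]; last first.
  by rewrite big1 // => i _; case: eqP => // ie; move: lt_de; lia.
have [lt_c|ge_c] := ltnP (d - e) (msize c).
  rewrite (bigD1 (Ordinal lt_c)) //= subnK // eqxx big1 ?addr0 // => i ic.
  case: eqP => // ie; case/eqP: ic; apply: val_inj => /=; lia.
rewrite big1 => [|i _]; last by case: eqP => // ie; have := ltn_ord i; lia.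
rewrite pihomogE big_seq_cond big_pred0 ?mul0r // => m.
apply/andP => -[/msize_mdeg_lt lt_m /eqP md].
by move: ge_c; rewrite -md leqNgt lt_m.
Qed.

(** Coefficients are replaced by their components of complementary degree. The last clause excludes
    nonzero constants when d < deg i, where d - deg i truncates to 0. *)
Lemma in_ideal_component (deg : nat -> nat) gs p d :
  (forall i, (i < size gs)%N -> gs`_i \is (deg i).-homog) -> in_ideal gs p ->
  exists c : nat -> {mpoly K[n]},
    [/\ pihomog mdeg d p = \sum_(i < size gs) c i * gs`_i,
        forall i, c i \is (d - deg i).-homog &
        forall i, (d < deg i)%N -> c i = 0].
Proof.
move=> gs_homog /in_idealP[c ->].
exists (fun i => if (deg i <= d)%N then pihomog mdeg (d - deg i) (c i) else 0).
split=> [|i|i]; last by rewrite ltnNge => /negPf->.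
  rewrite linear_sum; apply: eq_bigr => i _ /=.
  by rewrite (pihomogM _ _ (gs_homog i (ltn_ord i))) //; case: ifP; rewrite ?mul0r.
by case: ifP => _; rewrite ?pihomogP ?dhomog0.
Qed.

End Components.

(** * Macaulay's bound *)

Lemma common_exponent (n : nat) (P : 'I_n -> nat -> Prop) :
  (forall i N N', P i N -> (N <= N')%N -> P i N') ->
  (forall i, exists N, P i N) -> exists N, forall i, P i N.
Proof.
move=> mono /boolp.choice[N PN]; exists (\max_i N i)%N => i.
by apply: mono (PN i) _; apply: leq_bigmax.
Qed.

Lemma in_ideal_exp_le (R : comNzRingType) (gs : seq R) (a : R) N N' :
  (N <= N')%N -> in_ideal gs (a ^+ N) -> in_ideal gs (a ^+ N').
Proof. by move/subnK <-; rewrite exprD; apply: in_idealMl. Qed.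

(* Macaulay's bound for the socle degree of a complete intersection of n forms
   of degree delta. *)
Lemma macaulay_bound (K : fieldType) (n delta : nat) (gs : seq {mpoly K[n]})
    (p : {mpoly K[n]}) (t : nat) :
  size gs = n -> (0 < delta)%N -> (forall g, g \in gs -> g \is delta.-homog) ->
  (forall i : 'I_n, exists N, in_ideal gs ('X_i ^+ N)) ->
  p \is t.-homog -> (n * (delta - 1) + 1 <= t)%N -> in_ideal gs p.
Proof.
move=> sz_gs delta_gt0 gs_homog pow_gs pt le_t.
have [N0 gsN0] : exists N, forall i : 'I_n, in_ideal gs ('X_i ^+ N).
  apply: common_exponent pow_gs => i N N' + le_N.
  exact: in_ideal_exp_le.
(* The forms have degree delta, so the coefficients expressing X_k ^ N can be taken of degree N0. *)
pose N := (N0 + delta)%N.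
have /boolp.choice[c cP] : forall k : 'I_n, exists cs : seq {mpoly K[n]},
    [/\ size cs = size gs, 'X_k ^+ N = dotp cs gs &
        forall c, c \in cs -> c \is N0.-homog].
  move=> k; have gsN : in_ideal gs ('X_k ^+ N : {mpoly K[n]}).
    by apply: in_ideal_exp_le (gsN0 k); rewrite leq_addr.
  have gs_homog_nth j : (j < size gs)%N -> gs`_j \is ((fun=> delta) j).-homog.
      by move=> lt_j; apply/gs_homog/mem_nth.
    have [c [cE c_homog _]] := in_ideal_component N gs_homog_nth gsN.
  exists (mkseq c (size gs)); split.
  - by rewrite size_mkseq.
  - rewrite -(@pihomog_dE _ _ mdeg N ('X_k ^+ N)); last first.
      by rewrite mpolyXn dhomogX /= mdegMn mdeg1 mul1n.
    by rewrite cE; apply: eq_bigr => i _; rewrite nth_mkseq.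
  - by move=> _ /mapP[i _ ->]; have := c_homog i; rewrite /N addnK.
pose cs k := if insub k is Some i then c i else nseq (size gs) 0.
pose y k : {mpoly K[n]} := if insub k is Some i then 'X_i ^+ N else 0.
have csE (k : 'I_n) : cs k = c k by rewrite /cs valK.
have yE (k : 'I_n) : y k = 'X_k ^+ N by rewrite /y valK.
have size_cs k : size (cs k) = size gs.
  by rewrite /cs; case: insub => [i|]; [case: (cP i) | rewrite size_nseq].
apply: (@regular_sequence_descent _ gs n y cs (power_ideal N)) => //.
- by move=> k lt_k; rewrite (yE (Ordinal lt_k)) (csE (Ordinal lt_k)); case: (cP (Ordinal lt_k)).
- by move=> k; apply: power_ideal0.
- exact: power_idealB.
- exact: power_idealM.
- exact: power_ideal_nil.
- by move=> k lt_k q; rewrite (yE (Ordinal lt_k)); apply: (power_ideal_cons _ (Ordinal lt_k)).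
- by move=> k lt_k q; rewrite (yE (Ordinal lt_k)); apply: (power_idealX_cancel (k := Ordinal lt_k)).
have chain_homog k s : (k <= n)%N -> wedge_chain cs p k s \is (t + k * N0).-homog.
  elim: k s => [|k IHk] s lt_k /=; first by rewrite addn0; case: ifP; rewrite ?dhomog0.
  rewrite (csE (Ordinal lt_k)); case: (cP (Ordinal lt_k)) => _ _.
  move: (wedge_chain _ _ _) (IHk^~ (ltnW lt_k)) => w wk.
  rewrite mulSn addnCA.
  elim: (c _) w wk s => [|a l IHl] w wk [|b s] la /=; rewrite ?dhomog0 //.
  have IH b' s' : koszul_wedge l (fun t => w (b' :: t)) s' \is (N0 + (t + k * N0)).-homog.
    by apply: IHl => // x lx; apply: la; rewrite inE lx orbT.
  by case: b => //; rewrite rpredB // dhomogM // la ?mem_head.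
(* The coefficients have degree t + n N0, which exceeds n (N - 1) = n (delta - 1) + n N0. *)
move=> s _; apply: power_ideal_homog (chain_homog n s (leqnn n)) _.
have [->|n_gt0] := posnP n; first by lia.
have -> : (N - 1 = (delta - 1) + N0)%N by rewrite /N; lia.
by rewrite mulnDr; lia.
Qed.

(** * Reduction to n forms *)

Lemma mpolyX_neq0 (R : nzRingType) (n : nat) (m : 'X_{1..n}) :
  'X_[R, m] != 0.
Proof. by rewrite -mleadc_eq0 mleadXm mcoeffX eqxx oner_eq0. Qed.

Lemma in_ideal_congr_exp (R : comNzRingType) (gs : seq R) (a b : R) k :
  in_ideal gs (a - b) -> in_ideal gs (a ^+ k - b ^+ k).
Proof. by move=> ab; rewrite subrXX; apply: in_idealMr. Qed.

Lemma in_ideal_congr_mmap (K R : comNzRingType) (s : nat) (f : {rmorphism K -> R})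
    (gs : seq R) (a b : 'I_s -> R) (F : {mpoly K[s]}) :
  (forall i, in_ideal gs (a i - b i)) -> in_ideal gs (mmap f a F - mmap f b F).
Proof.
move=> ab; rewrite /mmap -sumrB; apply: in_ideal_sum => m _.
rewrite -mulrBr; apply: in_idealMl; rewrite /mmap1.
apply: (big_ind2 (fun x y => in_ideal gs (x - y))) => [|x x' z z' xx' zz'|i _].
- by rewrite subrr; apply: in_ideal0.
- rewrite (_ : _ - _ = x * (z - z') + (x - x') * z'); last by ring.
  by apply: in_idealD; [apply: in_idealMl | apply: in_idealMr].
- exact: in_ideal_congr_exp.
Qed.

Section LinearReduction.
Variables (K : fieldType) (n delta : nat).
Hypothesis K_infinite : forall s : seq K, exists x, x \notin s.
Hypothesis delta_gt0 : (0 < delta)%N.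

(* gs is algebraically dependent: for generic scalars lambda, a relation makes
   the last element of gs nilpotent modulo the forms g_i - lambda_i g_last. *)
Lemma drop_form (gs : seq {mpoly K[n]}) (s : nat) :
  size gs = s.+1 -> (n < s.+1)%N -> (forall g, g \in gs -> g \is delta.-homog) ->
  (forall i : 'I_n, exists N, in_ideal gs ('X_i ^+ N)) ->
  exists hs : seq {mpoly K[n]},
    [/\ size hs = s, forall h, h \in hs -> h \is delta.-homog,
        forall h, h \in hs -> in_ideal gs h &
        forall i : 'I_n, exists N, in_ideal hs ('X_i ^+ N)].
Proof.
move=> sz_gs lt_ns gs_homog pow_gs; pose g (i : 'I_s.+1) := gs`_i.
have gs_g i : g i \in gs by rewrite mem_nth ?sz_gs.
have [F F0 Fg] := mpoly_family_dependent g lt_ns.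
(* The extra factor makes the last coordinate of mu nonzero, so that the ratios lambda i can be
   formed. *)
have [|mu] := @mpoly_nonvanishing K K_infinite _ (F * 'X_ord_max).
  by rewrite mulf_neq0 ?mpolyX_neq0.
rewrite mevalM mevalXU mulf_eq0 negb_or => /andP[Fmu mu0].
pose l := g ord_max; pose lambda i := mu i / mu ord_max.
pose h i := g i - lambda i *: l.
pose hs := [seq h (widen_ord (leqnSn s) i) | i <- enum 'I_s].
have hs_h i : in_ideal hs (h i).
  have [ltis|] := ltnP i s.
    apply: mem_in_ideal; apply/mapP; exists (Ordinal ltis); rewrite ?mem_enum //.
    by congr h; apply: val_inj.
  move=> le_si; have -> : i = ord_max by apply/val_inj/eqP; rewrite eqn_leq le_si leq_ord.
  by rewrite /h /lambda divff // scale1r subrr; apply: in_ideal0.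
have l_homog k : l ^+ k \is (delta * k).-homog by apply: dhomogMn; apply: gs_homog (gs_g _).
(* q(T) = F(lambda T) takes the value F(mu) at the last coordinate of mu, hence is nonzero. *)
pose q : {poly K} := mmap polyC (fun i => lambda i *: 'X) F.
have q0 : q != 0.
  apply: contraNneq Fmu => q0; rewrite -(horner0 (mu ord_max)) -q0 /q /mmap horner_sum.
  rewrite mevalE; apply/eqP; apply: eq_bigr => m _; rewrite hornerM hornerC horner_prod.
  congr (_ * _); apply: eq_bigr => i _; rewrite horner_exp hornerZ hornerX.
  by rewrite divfK.
(* Modulo hs each g i is lambda i times l, so q(l) is congruent to F(g) = 0. *)
have ql : in_ideal hs (\sum_(k < size q) q`_k *: l ^+ k).
  suff <- : mmap (@mpolyC n K) (fun i => lambda i *: l) F = \sum_(k < size q) q`_k *: l ^+ k.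
    have := in_ideal_congr_mmap (@mpolyC n K) F hs_h.
    by rewrite Fg sub0r => /in_idealN; rewrite opprK.
  have -> : \sum_(k < size q) q`_k *: l ^+ k = (map_poly (@mpolyC n K) q).[l].
    rewrite horner_poly; apply: eq_bigr => k _; rewrite mul_mpolyC //.
  rewrite /q /mmap rmorph_sum horner_sum; apply: eq_bigr => m _.
  rewrite rmorphM hornerM /= map_polyC hornerC; congr (_ * _).
  rewrite /mmap1 rmorph_prod horner_prod; apply: eq_bigr => i _.
  by rewrite rmorphXn horner_exp /= map_polyZ map_polyX hornerZ hornerX mul_mpolyC.
(* The ideal of hs is homogeneous, so it contains the top component of q(l), a nonzero scalar times
   a power of l. *)
have [k lk] : exists k, in_ideal hs (l ^+ k).
  exists (size q).-1.
  have hs_homog j : (j < size hs)%N -> hs`_j \is ((fun=> delta) j).-homog.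
    by move/(mem_nth 0)/mapP => [i _ ->]; rewrite rpredB ?dhomogZ ?gs_homog ?gs_g.
  have [c [+ _ _]] := in_ideal_component (delta * (size q).-1) hs_homog ql.
  have : in_ideal hs (\sum_(i < size hs) c i * hs`_i) by apply/in_idealP; exists c.
  move=> /[swap] <-.
  have lt_q : ((size q).-1 < size q)%N by rewrite ltn_predL lt0n size_poly_eq0.
  rewrite linear_sum (bigD1 (Ordinal lt_q)) //= linearZ /= pihomog_dE // big1 ?addr0; last first.
    move=> j ne_j; rewrite linearZ /= (pihomog_ne0 _ (l_homog j)) ?scaler0 //.
    by rewrite eqn_pmul2l.
  move/(in_idealMl (lead_coef q)^-1%:MP); rewrite mul_mpolyC scalerA.
  by rewrite mulVf ?scale1r // lead_coef_eq0.
exists hs; split.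
- by rewrite size_map size_enum_ord.
- by move=> _ /mapP[i _ ->]; rewrite rpredB ?dhomogZ ?gs_homog ?gs_g.
- move=> _ /mapP[i _ ->]; apply: in_idealB; first exact/mem_in_ideal/gs_g.
  by rewrite -mul_mpolyC; apply/in_idealMl/mem_in_ideal/gs_g.
move=> i; have [N XN] := pow_gs i; exists (N * k)%N.
(* Modulo hs, X_i ^ N is a multiple of l, whose k-th power vanishes. *)
have [u [c]] : exists u c, 'X_i ^+ N = u + c * l /\ in_ideal hs u.
  move: XN; apply: (in_ideal_ind (P := fun p => exists u c, p = u + c * l /\ in_ideal hs u)).
  - by exists 0, 0; rewrite mul0r addr0; split=> //; apply: in_ideal0.
  - move=> p p' [u [c [-> ?]]] [u' [c' [-> ?]]]; exists (u + u'), (c + c').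
    by split; [ring | apply: in_idealD].
  move=> c _ /(nthP 0)[j lt_j <-].
  rewrite sz_gs in lt_j; exists (c * h (Ordinal lt_j)), (c * (lambda (Ordinal lt_j))%:MP).
  split; last exact: in_idealMl.
  by rewrite /h /g /= -mul_mpolyC; ring.
case=> XE hs_u; rewrite exprM -(subrK ((c * l) ^+ k) (_ ^+ k)); apply: in_idealD.
  by apply: in_ideal_congr_exp; rewrite XE addrK.
by rewrite exprMn; apply: in_idealMl.
Qed.

(** Forms are dropped one at a time until n remain; a shorter list is padded with zeros. *)
Lemma linear_system_of_parameters (gs : seq {mpoly K[n]}) :
  (forall g, g \in gs -> g \is delta.-homog) ->
  (forall i : 'I_n, exists N, in_ideal gs ('X_i ^+ N)) ->
  exists hs : seq {mpoly K[n]},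
    [/\ size hs = n, forall h, h \in hs -> h \is delta.-homog,
        forall h, h \in hs -> in_ideal gs h &
        forall i : 'I_n, exists N, in_ideal hs ('X_i ^+ N)].
Proof.
have [s] := ubnP (size gs); elim: s gs => // s IHs gs le_gs gs_homog pow_gs.
have [le_sn|lt_ns] := leqP (size gs) n.
  exists (gs ++ nseq (n - size gs) 0); split.
  - by rewrite size_cat size_nseq subnKC.
  - move=> h; rewrite mem_cat => /orP[/gs_homog //|/nseqP[-> _]].
    exact: dhomog0.
  - move=> h; rewrite mem_cat => /orP[/mem_in_ideal //|/nseqP[-> _]].
    exact: in_ideal0.
  move=> i; have [N XN] := pow_gs i; exists N; apply: in_ideal_trans XN => g gs_g.
  by apply: mem_in_ideal; rewrite mem_cat gs_g.
have sz_gs : size gs = (size gs).-1.+1 by rewrite prednK // (leq_ltn_trans _ lt_ns).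
have lt : (n < (size gs).-1.+1)%N by rewrite -sz_gs.
have [hs [sz_hs hs_homog gs_hs pow_hs]] := drop_form sz_gs lt gs_homog pow_gs.
have [|hs' [? ? hs_hs' ?]] := IHs hs _ hs_homog pow_hs; first by rewrite sz_hs -ltnS -sz_gs.
exists hs'; split=> // h /hs_hs'.
exact: in_ideal_trans.
Qed.

End LinearReduction.

(** * Minors *)

Lemma enum_val_ltn (p : nat) (S : {set 'I_p}) (i j : 'I_#|S|) :
  (i < j)%N -> (enum_val i < enum_val j)%N.
Proof.
move=> lt_ij; have x0 := enum_val i.
have srt : sorted (fun x y : 'I_p => x < y)%N (enum S).
  apply: sorted_filter => [x y z|]; first exact: ltn_trans.
  rewrite -enumT; have := iota_ltn_sorted 0 p.
  by rewrite -val_enum_ord sorted_map.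
rewrite !(enum_val_nth x0); apply: (sorted_ltn_nth (leT := fun x y : 'I_p => x < y)%N) => //.
- by move=> x y z; apply: ltn_trans.
- by rewrite inE -cardE.
- by rewrite inE -cardE.
Qed.

(** The independent rows given by [maxrankfun] need not come in order; enumerating the set of their
    indices sorts them and keeps the span. *)
Lemma increasing_rowsub (F : fieldType) (p q s : nat) (A : 'M[F]_(p, q)) :
  s = \rank A ->
  exists2 g : {ffun 'I_s -> 'I_p}, increasing g & row_free (rowsub g A).
Proof.
move=> ->; pose f := maxrankfun A; pose S := [set f i | i : 'I_(\rank A)].
have cardS : #|S| = \rank A.
  by rewrite card_imset ?card_ord //; apply: maxrankfun_inj.
exists [ffun i => enum_val (cast_ord (esym cardS) i)].
  apply/forallP => i; apply/forallP => j; apply/implyP => lt_ij; rewrite !ffunE.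
  exact: enum_val_ltn.
rewrite mxsub_ffunl; set B := rowsub _ A.
have : (rowsub f A <= B)%MS.
  apply/row_subP => i; have Si : f i \in S by apply: imset_f.
  rewrite row_rowsub.
  have -> : row (f i) A = row (cast_ord cardS (enum_rank_in Si (f i))) B.
    by rewrite row_rowsub cast_ordK enum_rankK_in.
  exact: row_sub.
move/mxrankS; rewrite (eqP (maxrowsub_free A)) => le_rank.
by rewrite /row_free eqn_leq rank_leq_row.
Qed.

(** Independent rows are selected first, then independent columns among them. *)
Lemma nonzero_minor (F : fieldType) (p q s : nat) (A : 'M[F]_(p, q)) :
  s = \rank A -> exists2 x, x \in minors s A & x != 0.
Proof.
move=> sE; have [g incr_g free_g] := increasing_rowsub sE.
have : s = \rank (rowsub g A)^T by rewrite mxrank_tr (eqP free_g).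
case/increasing_rowsub => h incr_h free_h.
exists (\det (mxsub g h A)).
  by apply/imageP; exists (g, h) => //; rewrite inE incr_g.
rewrite -det_tr -unitfE -unitmxE -row_free_unit.
by rewrite (_ : (mxsub g h A)^T = rowsub h (rowsub g A)^T) //; apply/matrixP => i j; rewrite !mxE.
Qed.

Lemma minor_neq0_rank (F : fieldType) (p q s : nat) (A : 'M[F]_(p, q)) x :
  x \in minors s A -> x != 0 -> (s <= \rank A)%N.
Proof.
case/imageP => -[g h] /= _ -> det_neq0.
have : row_free (mxsub g h A) by rewrite row_free_unit unitmxE unitfE.
move/eqP => <-; rewrite -mxrank_tr.
have -> : (mxsub g h A)^T = rowsub h (rowsub g A)^T by apply/matrixP => i j; rewrite !mxE.
apply: leq_trans (mxrankS (rowsub_sub _ _)) _; rewrite mxrank_tr.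
exact: mxrankS (rowsub_sub _ _).
Qed.

Lemma map_minors (R S : comNzRingType) (phi : {rmorphism R -> S}) (p q s : nat)
    (A : 'M[R]_(p, q)) : minors s (map_mx phi A) = map phi (minors s A).
Proof.
rewrite /minors /image_mem -map_comp; apply: eq_map => u /=.
by rewrite -map_mxsub det_map_mx.
Qed.

(** * Forms *)

Section Expo.
Variables n d : nat.

Lemma mdeg_expo (a : expo n d) : mdeg (expo_mnm a) = d.
Proof. exact/eqP/(valP a). Qed.

Lemma expo_mnm_inj : injective (@expo_mnm n d).
Proof. by move=> a b /val_inj/val_inj. Qed.

Lemma expo_mnm_exists (m : 'X_{1..n}) : mdeg m = d -> exists a : expo n d, expo_mnm a = m.
Proof.
move=> dm; have lt_md : (mdeg m < d.+1)%N by rewrite dm.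
have dmb : mdeg (BMultinom lt_md) == d by apply/eqP.
by exists (Sub (BMultinom lt_md) dmb).
Qed.

Lemma homog_expoE (R : nzRingType) (p : {mpoly R[n]}) :
  p \is d.-homog -> p = \sum_(a : expo n d) p@_(expo_mnm a) *: 'X_[expo_mnm a].
Proof.
move=> pd; apply/mpolyP => m; rewrite raddf_sum /=.
under eq_bigr => a _ do rewrite mcoeffZ mcoeffX.
have [dm|dm] := eqVneq (mdeg m) d; last first.
  rewrite (dhomog_nemf_coeff pd dm) big1 // => a _.
  have [am|] := eqVneq; last by rewrite mulr0.
  by rewrite -am mdeg_expo eqxx in dm.
have [a am] := expo_mnm_exists dm; rewrite -am (bigD1 a) //= eqxx mulr1.
rewrite big1 ?addr0 // => b ba; rewrite (inj_eq expo_mnm_inj) (negPf ba) mulr0 //.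
Qed.

End Expo.

Lemma card_expo (n t : nat) : (0 < n)%N -> #|{: expo n t}| = 'C(t + n - 1, n - 1).
Proof.
case: n => // n _; rewrite addnS !subn1 /=.
rewrite -[in RHS]bin_sub ?leq_addl // addnK -(size_basis n t) cardE.
rewrite -(size_map (@expo_mnm n.+1 t)); apply/perm_size/uniq_perm.
- by rewrite map_inj_uniq ?enum_uniq //; apply: expo_mnm_inj.
- exact: uniq_basis.
move=> m; rewrite -basis_cover; apply/mapP/eqP => [[a _ ->]|]; first exact: mdeg_expo.
by case/expo_mnm_exists => a <-; exists a; rewrite // mem_enum.
Qed.

Section Homogeneity.
Variables (A : comNzRingType) (n : nat).

Lemma dhomog_bigprod (I : Type) (r : seq I) (P : pred I) (e : I -> nat)
    (F : I -> {mpoly A[n]}) :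
  (forall i, P i -> F i \is (e i).-homog) ->
  \prod_(i <- r | P i) F i \is (\sum_(i <- r | P i) e i).-homog.
Proof.
move=> Fe; apply: (big_ind2 (fun (p : {mpoly A[n]}) k => p \is k.-homog)) => //.
- exact: dhomog1.
- by move=> p k q l; apply: dhomogM.
Qed.

Lemma mderiv_homog (d : nat) (p : {mpoly A[n]}) (i : 'I_n) :
  p \is d.-homog -> p^`M(i) \is (d - 1).-homog.
Proof.
move=> /dhomogP pd; apply/dhomogP => m /=.
rewrite mcoeff_msupp mcoeff_deriv => nz.
have /pd <- : (m + U_(i))%MM \in msupp p.
  by rewrite mcoeff_msupp; apply: contraNneq nz => ->; rewrite mul0rn.
by rewrite /= mdegD mdeg1 addnK.
Qed.

(** A minor has degree the sum of the d (u i) - 1, positive because m > 0 and all degrees are at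
    least 2. *)
Lemma minors_and_forms_homog (m : nat) (d : 'I_m -> nat) (f : 'I_m -> {mpoly A[n]}) h :
  (0 < m)%N -> (forall i, (2 <= d i)%N) -> (forall i, f i \is (d i).-homog) ->
  h \in minors_and_forms f -> exists2 e, (0 < e)%N & h \is e.-homog.
Proof.
move=> m_gt0 d_ge2 fd; rewrite mem_cat => /orP[|/mapP[i _ ->]]; last first.
  by exists (d i); rewrite // ltnW.
case/imageP => -[u v] _ -> /=; exists (\sum_(i < m) (d (u i) - 1))%N.
  rewrite (bigD1 (Ordinal m_gt0)) //=; apply: (leq_trans _ (leq_addr _ _)).
  by rewrite subn_gt0.
apply: rpred_sum => s _; rewrite rpredMsign.
by apply: dhomog_bigprod => i _; rewrite !mxE; apply: mderiv_homog.
Qed.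

Lemma homog_xdeg (p : {mpoly A[n]}) e : p \is e.-homog -> p \is (xdeg p).-homog.
Proof. exact: dhomog_msize. Qed.

End Homogeneity.

Section MapForms.
Variables (R S : comNzRingType) (phi : {rmorphism R -> S}) (n : nat).

Lemma map_mpoly_deriv (i : 'I_n) (p : {mpoly R[n]}) :
  map_mpoly phi p^`M(i) = (map_mpoly phi p)^`M(i).
Proof.
by apply/mpolyP => m; rewrite mcoeff_map_mpoly !mcoeff_deriv raddfMn mcoeff_map_mpoly.
Qed.

Lemma map_mpoly_homog d (p : {mpoly R[n]}) :
  p \is d.-homog -> map_mpoly phi p \is d.-homog.
Proof.
move=> /dhomogP pd; apply/dhomogP => m; rewrite mcoeff_msupp mcoeff_map_mpoly => nz.
by apply: pd; rewrite mcoeff_msupp; apply: contraNneq nz => ->; rewrite raddf0.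
Qed.

Lemma map_minors_and_forms m (f : 'I_m -> {mpoly R[n]}) :
  map (map_mpoly phi) (minors_and_forms f) =
  minors_and_forms (fun i => map_mpoly phi (f i)).
Proof.
rewrite /minors_and_forms map_cat -map_minors; congr (minors _ _ ++ _).
  by apply/matrixP => i j; rewrite !mxE /= map_mpoly_deriv.
by rewrite /image_mem -map_comp.
Qed.

End MapForms.

(** * The rank criterion *)

Section Criterion.
Variables (K : fieldType) (n m : nat) (d : 'I_m -> nat).
Hypotheses (n_gt0 : (0 < n)%N) (m_gt0 : (0 < m)%N) (d_ge2 : forall i, (2 <= d i)%N).

Let G := generic_gens K n d.
Let delta0 := delta K n d.

Lemma generic_form_homog j : generic_form K n d j \is (d j).-homog.
Proof.
by apply: rpred_sum => a _; apply: dhomogZ; rewrite dhomogX /= mdeg_expo.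
Qed.

Lemma mcoeff_generic_form j (a : expo n (d j)) :
  (generic_form K n d j)@_(expo_mnm a) = coord_var K a.
Proof.
rewrite raddf_sum /= (bigD1 a) //= mcoeffZ mcoeffX eqxx mulr1 big1 ?addr0 // => b ba.
by rewrite mcoeffZ mcoeffX (inj_eq (@expo_mnm_inj _ _)) (negPf ba) mulr0.
Qed.

Lemma generic_gens_homog h : h \in G -> h \is (xdeg h).-homog.
Proof.
move/(minors_and_forms_homog m_gt0 d_ge2 generic_form_homog) => [e _].
exact: homog_xdeg.
Qed.

Lemma xdeg_le_delta h : h \in G -> (xdeg h <= delta0)%N.
Proof. by move=> Gh; apply: leq_bigmax_seq. Qed.

Lemma delta_gt0 : (0 < delta0)%N.
Proof.
pose j := Ordinal m_gt0; pose f := generic_form K n d j.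
have Gf : f \in G by rewrite mem_cat orbC; apply/orP; left; apply: map_f; rewrite mem_enum.
apply: leq_trans (xdeg_le_delta Gf); rewrite /xdeg.
have [a _] : exists a : expo n (d j), expo_mnm a = (U_(Ordinal n_gt0) *+ d j)%MM.
  by apply: expo_mnm_exists; rewrite mdegMn mdeg1 mul1n.
have fa : expo_mnm a \in msupp f.
  by rewrite mcoeff_msupp mcoeff_generic_form mpolyX_neq0.
have := msize_mdeg_lt fa; rewrite mdeg_expo => lt_d.
by have := leq_trans (d_ge2 j) (ltnW lt_d); case: (msize f) => [|[|s]].
Qed.

(** Since n and delta are positive, delta <= n (delta - 1) + 1; hence no subtraction t0 - xdeg h in
    [rows_N] is truncated. *)
Lemma xdeg_le_t0 h : h \in G -> (xdeg h <= t0 K n d)%N.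
Proof.
move/xdeg_le_delta; rewrite /t0 -/delta0; have := leq_pmull (delta0 - 1) n_gt0.
by have := delta_gt0; move: (n * _)%N => k; lia.
Qed.

Lemma rows_NP t x :
  reflect (exists h a, [/\ h \in G & x = h * 'X_[@expo_mnm n (t - xdeg h) a]])
          (x \in rows_N K n d t).
Proof.
apply: (iffP allpairsPdep) => [[h [a [Gh _ ->]]]|[h [a [Gh ->]]]]; exists h, a => //.
by rewrite mem_enum.
Qed.

Lemma rows_N_homog t x :
  (forall h, h \in G -> (xdeg h <= t)%N) -> x \in rows_N K n d t -> x \is t.-homog.
Proof.
move=> le_t /rows_NP[h [a [Gh ->]]]; rewrite -{2}(subnKC (le_t h Gh)).
by apply: dhomogM; [apply: generic_gens_homog | rewrite dhomogX /= mdeg_expo].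
Qed.

(** The specialization phi will be evaluation at a coordinate vector, and also the embedding into
    the fraction field. *)
Variables (L : fieldType) (phi : {rmorphism coord_ring K n d -> L}).

Let Gphi := map (map_mpoly phi) G.

Lemma rows_N_in_ideal t x : x \in rows_N K n d t -> in_ideal Gphi (map_mpoly phi x).
Proof.
case/rows_NP => h [a [Gh ->]]; rewrite rmorphM; apply/in_idealMr/mem_in_ideal.
exact: map_f.
Qed.

Let N t := map_mx phi (Nmx K n d t).

(** With full column rank, the coefficient vector of any form of degree t is a combination of the
    rows, which represent elements of the ideal. *)
Lemma row_full_in_ideal t p : (forall h, h \in G -> (xdeg h <= t)%N) ->
  row_full (N t) -> p \is t.-homog -> in_ideal Gphi p.
Proof.
move=> le_t full_N pt.
pose v : 'rV[L]_#|expo n t| := \row_j p@_(@expo_mnm n t (enum_val j)).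
have /submxP[D vE] : (v <= N t)%MS by apply: submx_full.
suff -> : p = \sum_i (D 0 i)%:MP * map_mpoly phi (rows_N K n d t)`_i.
  by apply: in_ideal_sum => i _; apply/in_idealMl/(@rows_N_in_ideal t)/mem_nth.
apply/mpolyP => a; rewrite raddf_sum /=.
have [da|da] := eqVneq (mdeg a) t; last first.
  rewrite (dhomog_nemf_coeff pt da) big1 // => i _.
  rewrite mcoeffCM mcoeff_map_mpoly (dhomog_nemf_coeff (rows_N_homog le_t _) da).
    by rewrite raddf0 mulr0.
  exact: mem_nth.
have [b <-] := expo_mnm_exists da.
have := congr1 (fun w : 'rV__ => w 0 (enum_rank b)) vE.
rewrite !mxE enum_rankK => ->; apply: eq_bigr => i _.
by rewrite !mxE enum_rankK mcoeffCM mcoeff_map_mpoly.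
Qed.

(** Each monomial of degree t is a combination of the generators with homogeneous coefficients;
    expanding these into monomials exhibits it as a combination of rows. *)
Lemma in_ideal_row_full t :
  (forall p, p \is t.-homog -> in_ideal Gphi p) -> row_full (N t).
Proof.
move=> homog_Gphi; pose crow (p : {mpoly L[n]}) : 'rV[L]_#|expo n t| :=
  \row_j p@_(@expo_mnm n t (enum_val j)).
have crow_row x : x \in rows_N K n d t -> (crow (map_mpoly phi x) <= N t)%MS.
  move=> /(nthP 0)[i lt_i <-].
  have -> : crow (map_mpoly phi (rows_N K n d t)`_i) = row (Ordinal lt_i) (N t).
    by apply/rowP => j; rewrite !mxE mcoeff_map_mpoly.
  exact: row_sub.
have crow_sum (I : finType) (F : I -> {mpoly L[n]}) :
    (forall i, (crow (F i) <= N t)%MS) -> (crow (\sum_i F i)%R <= N t)%MS.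
  move=> subF; rewrite (_ : crow _ = \sum_i crow (F i)); first exact: summx_sub.
  by apply/rowP => j; rewrite summxE mxE raddf_sum; apply: eq_bigr => i _; rewrite mxE.
have crowZ c p : (crow p <= N t)%MS -> (crow (c *: p)%R <= N t)%MS.
  move=> subp; rewrite (_ : crow _ = c *: crow p); first exact: scalemx_sub.
  by apply/rowP => j; rewrite !mxE mcoeffZ.
rewrite -sub1mx; apply/row_subP => j; set a : expo n t := enum_val j.
have Xt : 'X_[L, expo_mnm a] \is t.-homog by rewrite dhomogX /= mdeg_expo.
have -> : row j 1%:M = crow 'X_[L, expo_mnm a].
  apply/rowP => k; rewrite !mxE mcoeffX (inj_eq (@expo_mnm_inj _ _)).
  by rewrite (inj_eq enum_val_inj).
have Gphi_homog i : (i < size Gphi)%N -> Gphi`_i \is (xdeg G`_i).-homog.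
  rewrite size_map => lt_i; rewrite (nth_map 0) //.
  by apply/map_mpoly_homog/generic_gens_homog/mem_nth.
have [c [XE c_homog c0]] := in_ideal_component t Gphi_homog (homog_Gphi _ Xt).
rewrite -(pihomog_dE Xt) XE; apply: (crow_sum) => i.
have lt_i : (i < size G)%N by rewrite -(size_map (map_mpoly phi)) ltn_ord.
rewrite (homog_expoE (c_homog i)) mulr_suml; apply: (crow_sum) => b.
rewrite -scalerAl; apply: (crowZ); rewrite (nth_map 0) // mulrC.
have -> : 'X_[L, expo_mnm b] = map_mpoly phi 'X_[expo_mnm b] by rewrite map_mpolyX.
rewrite -rmorphM; apply/crow_row/rows_NP.
by exists G`_i, b; rewrite mem_nth.
Qed.

Hypothesis L_infinite : forall s : seq L, exists x, x \notin s.

(** The generators are replaced by their monomial multiples of degree delta, these by n linear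
    combinations, to which Macaulay's bound applies. *)
Lemma powers_in_ideal_t0 p : (forall i : 'I_n, exists N, in_ideal Gphi ('X_i ^+ N)) ->
  p \is (t0 K n d).-homog -> in_ideal Gphi p.
Proof.
move=> powG pt; pose hs := map (map_mpoly phi) (rows_N K n d delta0).
have hs_homog h : h \in hs -> h \is delta0.-homog.
  by case/mapP => x /(rows_N_homog xdeg_le_delta) xd ->; apply: map_mpoly_homog.
have hs_G h : h \in hs -> in_ideal Gphi h by case/mapP => x /rows_N_in_ideal ? ->.
have pow_hs (i : 'I_n) : exists N, in_ideal hs ('X_i ^+ N).
  (* The extra factor X_i ^ delta raises each generator to degree delta. *)
  have [N0 XN] := powG i; exists (N0 + delta0)%N; rewrite exprD.
  move: XN; apply: (in_ideal_ind (P := fun p => in_ideal hs (p * 'X_i ^+ delta0))).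
  - by rewrite mul0r; apply: in_ideal0.
  - by move=> q q' ? ?; rewrite mulrDl; apply: in_idealD.
  move=> c _ /mapP[h Gh ->].
  have [a aE] : exists a : expo n (delta0 - xdeg h), expo_mnm a = (U_(i) *+ (delta0 - xdeg h))%MM.
    by apply: expo_mnm_exists; rewrite mdegMn mdeg1 mul1n.
  have -> : c * map_mpoly phi h * 'X_i ^+ delta0 =
      (c * 'X_i ^+ xdeg h) * map_mpoly phi (h * 'X_[expo_mnm a]).
    rewrite rmorphM /= map_mpolyX aE -mpolyXn -{1}(subnK (xdeg_le_delta Gh)) exprD.
    by rewrite [RHS]mulrACA; congr (_ * _); rewrite mulrC.
  by apply/in_idealMl/mem_in_ideal/map_f/rows_NP; exists h, a.
have [gs [sz_gs gs_homog gs_hs pow_gs]] :=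
  linear_system_of_parameters L_infinite delta_gt0 hs_homog pow_hs.
apply: (in_ideal_trans hs_G); apply: (in_ideal_trans gs_hs).
exact: macaulay_bound sz_gs delta_gt0 gs_homog pow_gs pt (leqnn _).
Qed.

(** The minors have as many columns as the matrix, so a nonzero one means full column rank, that is,
    all forms of degree t0 lie in the ideal. *)
Lemma minor_criterion :
  (exists2 F, F \in minors 'C(t0 K n d + n - 1, n - 1) (Nmx K n d (t0 K n d)) & phi F != 0)
  <-> forall i : 'I_n, exists N, in_ideal Gphi ('X_i ^+ N).
Proof.
split=> [[F minF phiF] i|powG].
  exists (t0 K n d); apply: (@row_full_in_ideal (t0 K n d)); first exact: xdeg_le_t0.
    have : phi F \in minors 'C(t0 K n d + n - 1, n - 1) (N (t0 K n d)).
      by rewrite map_minors map_f.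
    move/minor_neq0_rank/(_ phiF); rewrite -card_expo // => le_rank.
    by rewrite /row_full eqn_leq rank_leq_col.
  by rewrite mpolyXn dhomogX /= mdegMn mdeg1 mul1n.
have full_N : row_full (N (t0 K n d)).
  by apply: in_ideal_row_full => p; apply: powers_in_ideal_t0.
have rank_N : 'C(t0 K n d + n - 1, n - 1) = \rank (N (t0 K n d)).
  by rewrite (eqP full_N) -card_expo.
have [x + x0] := nonzero_minor rank_N.
by rewrite map_minors => /mapP[F minF xE]; exists F; rewrite // -xE.
Qed.

End Criterion.

(** * Height n *)

Section HomogeneousIdeals.
Variables (K : fieldType) (n : nat).

Lemma mmap_origin (p : {mpoly K[n]}) :
  mmap (@mpolyC n K) (fun=> 0) p = (p@_0%MM)%:MP.
Proof.
rewrite {2}[p]mpolyE raddf_sum /= rmorph_sum; apply: eq_bigr => m _.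
rewrite mcoeffZ mcoeffX rmorphM; congr (_ * _); rewrite /mmap1.
have [->|m0] := eqVneq m 0%MM; first by rewrite big1 // => i _; rewrite mnm0E.
have [i mi] : exists i, m i != 0%N.
  apply: boolp.contrapT => all0; case/eqP: m0; apply/mnmP => i; rewrite mnm0E.
  by apply/eqP; apply: contra_notT all0 => mi; exists i.
by rewrite (bigD1 i) //= expr0n (negPf mi) mul0r.
Qed.

Let restrict l (i : 'I_n) : {mpoly K[n]} := if (i < l)%N then 0 else 'X_i.

(** P l is the kernel of the substitution killing the first l variables. Inclusions hold because
    killing l variables and then l + 1 is the same as killing l + 1. *)
Lemma coordinate_primes : exists P : nat -> prime_idealr {mpoly K[n]},
  prime_chain n P /\ forall p, (p \in (P n : {pred _})) = (p@_0%MM == 0).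
Proof.
have /boolp.choice[P PE] : forall l, exists Q : prime_idealr {mpoly K[n]},
    forall p, (p \in (Q : {pred _})) = (mmap (@mpolyC n K) (restrict l) p == 0).
  by move=> l; apply: kernel_prime.
exists P; split=> [l lt_l|p]; last first.
  rewrite PE (_ : restrict n = fun=> 0) ?mmap_origin ?mpolyC_eq0 //.
  by apply: boolp.funext => i; rewrite /restrict ltn_ord.
split=> [p|]; last first.
  exists 'X_(Ordinal lt_l); rewrite PE mmapX mmap1U /restrict ?ltnSn //= ltnn.
  exact: mpolyX_neq0.
rewrite !PE => /eqP Pp.
have -> : mmap (@mpolyC n K) (restrict l.+1) p =
    mmap (@mpolyC n K) (restrict l.+1) (mmap (@mpolyC n K) (restrict l) p).
  rewrite mmap_mmap; congr mmap; apply: boolp.funext => i.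
  rewrite /restrict; case: (ltnP i l) => il; first by rewrite mmap0 ltnW.
  by rewrite mmapX mmap1U.
by rewrite Pp mmap0.
Qed.

(** Modulo the variables p is its constant term, and nonzero constants are units. *)
Lemma prime_containing_variables (Q : prime_idealr {mpoly K[n]}) p :
  (forall i, 'X_i \in (Q : {pred _})) -> (p \in (Q : {pred _})) = (p@_0%MM == 0).
Proof.
move=> QX; have : p - (p@_0%MM)%:MP \in (Q : {pred _}).
  have pE : p = mmap (@mpolyC n K) (fun i => 'X_i) p.
    by rewrite {1}[p]mpolyE; apply: eq_bigr => m _; rewrite mul_mpolyC mpolyXE_id.
  rewrite {1}pE -mmap_origin.
  have : in_ideal [seq 'X_i | i : 'I_n] (mmap (@mpolyC n K) (fun i => 'X_i) p
                   - mmap (@mpolyC n K) (fun=> 0) p).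
    apply: in_ideal_congr_mmap => i; rewrite subr0.
    by apply/mem_in_ideal/map_f; rewrite mem_enum.
  move: (_ - _); apply: in_ideal_ind => [|a b|c _ /mapP[i _ ->]]; first exact: idealr0.
    exact: rpredD.
  exact: idealMr.
move=> Qp; rewrite -{1}(subrK (p@_0%MM)%:MP p) rpredDl //.
have [->|c0] := eqVneq p@_0%MM 0; first by rewrite idealr0.
apply/negP => /(idealMr (p@_0%MM)^-1%:MP).
by rewrite -mpolyCM mulVf // mpolyC1 idealr1.
Qed.

Variable gs : seq {mpoly K[n]}.
Hypothesis gs_homog : forall g, g \in gs -> exists2 e, (0 < e)%N & g \is e.-homog.

Lemma homog_mcoeff0 (g : {mpoly K[n]}) : g \in gs -> g@_0%MM = 0.
Proof.
by case/gs_homog => e e0 ge; apply: (dhomog_nemf_coeff ge); rewrite /= mdeg0 eq_sym -lt0n.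
Qed.

Lemma in_ideal_mcoeff0 p : in_ideal gs p -> p@_0%MM = 0.
Proof.
move: p; apply: in_ideal_ind => [|p q p0 q0|c g /homog_mcoeff0 g0].
- exact: mcoeff0.
- by rewrite mcoeffD p0 q0 addr0.
by apply/eqP; rewrite -(mpolyC_eq0 n) -mmap_origin rmorphM /= !mmap_origin g0 mulr0.
Qed.

(** A prime containing the ideal contains every variable, hence is the irrelevant ideal, which ends
    the chain of coordinate primes; no chain is longer. *)
Lemma has_height_powers :
  (forall i : 'I_n, exists N, in_ideal gs ('X_i ^+ N)) -> has_height (in_ideal gs) n.
Proof.
move=> powX; have [P [chP PnE]] := coordinate_primes.
split=> [Q gsQ|].
  exists P => // p; rewrite PnE -(prime_containing_variables (Q := Q)) // => i.
  have [N /gsQ QX] := powX i; apply: contraLR QX; exact: prime_expr.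
case/(_ (P n)) => [p /in_ideal_mcoeff0 p0|P' chP' _]; first by rewrite PnE p0.
exact: no_long_prime_chain chP'.
Qed.

(* A prime of gs avoiding X_i would contain a homogeneous prime of gs, of
   height less than n since it lies strictly below the irrelevant ideal; that
   homogeneous prime is the kernel of p |-> p(tx) modulo the given prime. *)
Lemma powers_has_height :
  height_ge (in_ideal gs) n -> forall i : 'I_n, exists N, in_ideal gs ('X_i ^+ N).
Proof.
move=> ht_gs i; apply: boolp.contrapT => noN.
have [|D [f [f_gs fXi]]] := @domain_avoiding _ gs 'X_i.
  by move=> N XN; apply: noN; exists N.
pose sigma : {mpoly K[n]} -> {poly D} :=
  mmap (polyC \o (f \o @mpolyC n K)) (fun j => (f 'X_j)%:P * 'X).
(* On forms of degree e, sigma is f times t ^ e, so Q contains the homogeneous generators. *)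
have sigmaE p e : p \is e.-homog -> sigma p = (f p)%:P * 'X ^+ e.
  move=> /dhomogP pe; rewrite /sigma /mmap {3}[p]mpolyE !rmorph_sum mulr_suml.
  rewrite big_seq [RHS]big_seq; apply: eq_bigr => m /pe <-.
  rewrite -mul_mpolyC !rmorphM -mulrA; congr (_ * _).
  rewrite mpolyXE_id rmorph_prod rmorph_prod /= mdegE expr_sum -big_split.
  apply: eq_bigr => j _; rewrite exprMn rmorphXn rmorphXn //.
have [Q QE] : exists Q : prime_idealr {mpoly K[n]},
    forall p, (p \in (Q : {pred _})) = (sigma p == 0).
  exact: kernel_prime.
have gsQ p : in_ideal gs p -> p \in (Q : {pred _}).
  move: p; apply: in_ideal_ind => [|a b|c g gs_g]; first exact: idealr0.
    exact: rpredD.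
  apply: idealMr; have [e _ ge] := gs_homog gs_g.
  by rewrite QE (sigmaE _ _ ge) f_gs ?mul0r //; apply: mem_in_ideal.
have [P0 [_ MnE]] := coordinate_primes; set M := P0 n in MnE.
have QM : {subset (Q : {pred _}) <= (M : {pred _})}.
  move=> p; rewrite QE MnE => /eqP sp.
  have : f ((p@_0%MM)%:MP) = 0.
    have <- : (sigma p).[0] = 0 by rewrite sp horner0.
    rewrite -mmap_origin /sigma /mmap horner_sum rmorph_sum.
    apply: eq_bigr => m _; rewrite rmorphM hornerM /= hornerC; congr (_ * _).
    rewrite /mmap1 horner_prod rmorph_prod; apply: eq_bigr => j _.
    by rewrite horner_exp hornerM hornerX mulr0 rmorphXn rmorph0.
  have [//|c0 fc] := eqVneq p@_0%MM 0.
  have /eqP := oner_neq0 D; case.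
  by rewrite -(rmorph1 f) -mpolyC1 -(mulVf c0) mpolyCM rmorphM fc mulr0.
have [P chP PnE] := ht_gs Q gsQ.
(* Since M contains X_i and Q does not, appending M to a chain of length n ending at Q gives one of
   length n + 1. *)
apply: (@no_long_prime_chain K n (fun l => if (l <= n)%N then P l else M)) => l.
rewrite ltnS => le_l; rewrite le_l.
have [lt_l|ge_l] := ltnP l n; first exact: chP.
have -> : l = n by apply/eqP; rewrite eqn_leq le_l.
split=> [p|]; first by rewrite PnE; apply: QM.
exists 'X_i; first by rewrite MnE mcoeffX mnm1_eq0.
rewrite PnE QE /sigma mmapX mmap1U mulf_neq0 ?polyX_eq0 ?polyC_eq0 //.
Qed.

Lemma has_heightP :
  has_height (in_ideal gs) n <-> forall i : 'I_n, exists N, in_ideal gs ('X_i ^+ N).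
Proof. by split=> [[/powers_has_height]|/has_height_powers]. Qed.

End HomogeneousIdeals.

(** * The dimension count *)

Section DimensionCount.
Variables (K : fieldType) (n m : nat) (d : 'I_m -> nat).
Hypothesis d_gt0 : forall j, (0 < d j)%N.
Variables (E : fieldType) (kappa : {rmorphism K -> E}).
Variables (y : forall j, expo n (d j) -> E) (eta : 'I_n -> E) (lambda : 'I_m -> E).
Variables (i0 : 'I_n) (j0 : 'I_m).
Hypotheses (eta1 : eta i0 = 1) (lambda1 : lambda j0 = 1).
Hypothesis form_eq0 : forall j, \sum_(a : expo n (d j)) y a * mmap1 eta (expo_mnm a) = 0.
Hypothesis gradient_eq0 : forall k, \sum_j lambda j *
  \sum_(a : expo n (d j)) y a * (expo_mnm a k)%:R * mmap1 eta (expo_mnm a - U_(k))%MM = 0.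

(** [top] marks the coefficient of X_(i0) ^ (d j), to be solved for in the j-th form equation;
    [subtop] marks those of X_(i0) ^ (d j0 - 1) X_k in form j0, to be solved for in the k-th
    gradient equation. *)
Let top j (a : expo n (d j)) := expo_mnm a i0 == d j.
Let subtop j (a : expo n (d j)) := (j == j0) && (expo_mnm a i0 == d j - 1)%N.

Lemma mdeg_remainder j (a : expo n (d j)) :
  mdeg (expo_mnm a - U_(i0) *+ expo_mnm a i0)%MM = (d j - expo_mnm a i0)%N.
Proof.
have le_a : (U_(i0) *+ expo_mnm a i0 <= expo_mnm a)%MM.
  apply/mnm_lepP => i; rewrite mulmnE mnm1E.
  by case: eqVneq => [<-|]; rewrite ?mul1n ?mul0n.
have := congr1 mdeg (submK le_a); rewrite mdegD mdeg_expo mdegMn mdeg1 mul1n => dE.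
by rewrite -[X in (X - _)%N]dE addnK.
Qed.

Lemma top_mnm j (a : expo n (d j)) : top a -> expo_mnm a = (U_(i0) *+ d j)%MM.
Proof.
move=> /eqP ai; have := mdeg_remainder a; rewrite ai subnn => /eqP.
rewrite mdeg_eq0 => /eqP a0; apply/mnmP => i; have := congr1 (fun u : 'X_{1..n} => u i) a0.
rewrite mnmBE mnm0E mulmnE mnm1E; case: eqVneq => [<-|_]; first by rewrite ai mul1n.
by rewrite mul0n subn0.
Qed.

Lemma subtop_mnm (a : expo n (d j0)) : subtop a ->
  exists2 k, k != i0 & expo_mnm a = (U_(i0) *+ (d j0 - 1)%N + U_(k))%MM.
Proof.
move=> /andP[_ /eqP ai]; have := mdeg_remainder a.
rewrite ai subKn ?d_gt0 // => /eqP/mdeg1P[k /eqP ak].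
have coord i : expo_mnm a i = ((U_(i0) *+ (d j0 - 1)%N)%MM i + U_(k)%MM i)%N.
  rewrite -ak mnmBE mulmnE mnm1E; case: eqVneq => [<-|_]; first by rewrite ai mul1n subnn addn0.
  by rewrite mul0n subn0.
exists k; last by apply/mnmP => i; rewrite coord mnmDE.
by apply/eqP => ki; have := coord i0; rewrite ki mulmnE mnm1E ai eqxx; lia.
Qed.

Lemma mmap1_eta_power e : mmap1 eta (U_(i0) *+ e)%MM = 1.
Proof.
rewrite /mmap1 big1 // => i _; rewrite mulmnE mnm1E.
by case: eqVneq => [<-|]; rewrite ?eta1 ?expr1n ?mul0n.
Qed.

(* The coordinates of generic forms singular at a point of their zero set lie
   in the algebra generated by one element fewer: n - 1 coordinates eta of the
   point and m - 1 coefficients lambda of the linear relation among gradients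
   replace the m + n - 1 coordinates which the m + n - 1 equations determine. *)
Let z (c : coord_index n d) : E :=
  let: existT j a := c in
  if top a then lambda j
  else if subtop a then \sum_(k | k != i0) (expo_mnm a k)%:R * eta k
  else y a.

Lemma mdeg_power e : mdeg (U_(i0) *+ e)%MM = e.
Proof. by rewrite mdegMn mdeg1 mul1n. Qed.

(** The values of z generate an algebra containing every coefficient y. One of them, at c0, is
    lambda j0 = 1 and can be omitted, which leaves fewer generators than coefficients. *)
Lemma singular_forms_dependent :
  exists2 F : {mpoly K[#|coord_index n d|]}, F != 0 &
    mmap kappa (fun c => y (tagged (enum_val c))) F = 0.
Proof.
have top_exists j : exists a : expo n (d j), top a.
  have [a aE] := expo_mnm_exists (mdeg_power (d j)).
  by exists a; rewrite /top aE mulmnE mnm1E eqxx mul1n.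
have [a0 top_a0] := top_exists j0.
pose c0 : coord_index n d := Tagged (fun j => expo n (d j)) a0.
pose r0 := enum_rank c0.
pose z' (k : 'I_#|coord_index n d|.-1) := z (enum_val (lift r0 k)).
pose gen e := exists P, e = mmap kappa z' P.
have genD a b : gen a -> gen b -> gen (a + b).
  by move=> [P ->] [Q ->]; exists (P + Q); rewrite rmorphD.
have genM a b : gen a -> gen b -> gen (a * b).
  by move=> [P ->] [Q ->]; exists (P * Q); rewrite rmorphM.
have genN a : gen a -> gen (- a) by move=> [P ->]; exists (- P); rewrite rmorphN.
have gen0 : gen 0 by exists 0; rewrite rmorph0.
have gen1 : gen 1 by exists 1; rewrite rmorph1.
have genX a k : gen a -> gen (a ^+ k) by move=> [P ->]; exists (P ^+ k); rewrite rmorphXn.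
have gen_nat k : gen k%:R by exists k%:R; rewrite rmorph_nat.
have gen_sum (I : finType) (P : pred I) (F : I -> E) :
    (forall i, P i -> gen (F i)) -> gen (\sum_(i | P i) F i).
  by move=> genF; apply: big_ind.
have gen_mmap1 u : (forall k, gen (eta k)) -> gen (mmap1 eta u).
  by move=> gen_eta; rewrite /mmap1; apply: big_ind => // i _; apply: genX.
have gen_z c : gen (z c).
  have [cc0|] := eqVneq c c0; first by rewrite cc0 /z /= top_a0 lambda1.
  rewrite -(inj_eq enum_rank_inj) eq_sym -/r0 => /unlift_some[k kE _].
  by exists 'X_k; rewrite mmapX mmap1U /z' -kE enum_rankK.
have gen_lambda j : gen (lambda j).
  have [a top_a] := top_exists j.
  by have := gen_z (Tagged (fun j => expo n (d j)) a); rewrite /z /= top_a.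
(* At the monomial X_(i0) ^ (d j0 - 1) X_k the sum defining z reduces to eta k. *)
have gen_eta k : gen (eta k).
  have [->|ki] := eqVneq k i0; first by rewrite eta1.
  have [|a aE] := @expo_mnm_exists n (d j0) (U_(i0) *+ (d j0 - 1)%N + U_(k))%MM.
    by rewrite mdegD mdeg_power mdeg1 subnK.
  have := gen_z (Tagged (fun j => expo n (d j)) a); rewrite /z /= /top /subtop aE.
  rewrite !mnmDE !mulmnE !mnm1E eqxx (negPf ki) mul1n addn0 !eqxx /=.
  have -> : (d j0 - 1 == d j0)%N = false by have := d_gt0 j0; lia.
  rewrite (bigD1 k) //= big1 ?addr0.
    rewrite mnmDE mulmnE !mnm1E eqxx eq_sym (negPf ki) mul0n mul1r //.
  move=> l /andP[li lk]; rewrite mnmDE mulmnE !mnm1E.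
  by rewrite ![_ == l]eq_sym (negPf li) (negPf lk) mul0r.
have gen_regular j (a : expo n (d j)) : ~~ top a -> ~~ subtop a -> gen (y a).
  move=> ntop nsub; have := gen_z (Tagged (fun j => expo n (d j)) a).
  by rewrite /z /= (negPf ntop) (negPf nsub).
(* In the k-th gradient equation this coefficient has factor 1, in any characteristic, as X_k occurs
   once. The other monomials divisible by X_k are neither [top] nor [subtop]. *)
have gen_subtop (a : expo n (d j0)) : subtop a -> gen (y a).
  move=> sub_a; have [k ki aE] := subtop_mnm sub_a.
  have := gradient_eq0 k; rewrite (bigD1 j0) //= (bigD1 a) //= lambda1 mul1r.
  rewrite {1 2}aE addmK mmap1_eta_power mulr1 mnmDE mulmnE !mnm1E eqxx.
  rewrite eq_sym (negPf ki) mul0n mulr1 -addrA => /eqP; rewrite addr_eq0 => /eqP->.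
  have gen_term j (b : expo n (d j)) : Tagged (fun j => expo n (d j)) b !=
      Tagged (fun j => expo n (d j)) a ->
      gen (y b * (expo_mnm b k)%:R * mmap1 eta (expo_mnm b - U_(k))%MM).
    move=> ba; have [->|bk] := eqVneq (expo_mnm b k) 0%N; first by rewrite mulr0 mul0r.
    apply: (genM); last exact: gen_mmap1.
    apply: (genM); last exact: gen_nat.
    have ntop : ~~ top b.
      by apply: contraNN bk => /top_mnm->; rewrite mulmnE mnm1E [i0 == k]eq_sym (negPf ki).
    apply: gen_regular => //; apply: contraNN ba => sub_b.
    have jj0 : j = j0 by case/andP: sub_b => /eqP.
    subst j; have [l li bE] := subtop_mnm sub_b.
    have lk : l = k.
      apply/eqP; apply: contraNT bk => lk; rewrite bE mnmDE mulmnE !mnm1E.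
      by rewrite [i0 == k]eq_sym (negPf ki) (negPf lk).
    by apply/eqP; congr existT; apply: expo_mnm_inj; rewrite bE aE lk.
  apply: genN; apply: genD; apply: (gen_sum) => j jj0.
    by apply: gen_term; rewrite -tag_eqE /tag_eq /= eqxx /= tagged_asE.
  apply: genM => //; apply: gen_sum => b _; apply: gen_term.
  by rewrite -tag_eqE /tag_eq /= (negPf jj0).
have gen_ntop j (a : expo n (d j)) : ~~ top a -> gen (y a).
  move=> ntop; have [sub_a|] := boolP (subtop a); last exact: gen_regular.
  have jj0 : j = j0 by case/andP: sub_a => /eqP.
  by subst j; apply: gen_subtop.
(* The form equation gives the [top] coefficient, whose monomial takes the value 1 at eta. *)
have gen_y j (a : expo n (d j)) : gen (y a).
  have [top_a|] := boolP (top a); last exact: gen_ntop.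
  have := form_eq0 j; rewrite (bigD1 a) //= {1}(top_mnm top_a) mmap1_eta_power mulr1.
  move/eqP; rewrite addr_eq0 => /eqP->; apply: genN; apply: gen_sum => b ba.
  apply: genM; last exact: gen_mmap1.
  apply: gen_ntop; apply: contraNN ba => top_b; apply/eqP/expo_mnm_inj.
  by rewrite !top_mnm.
apply: (algebraically_dependent (z := z')) => [|c]; last exact: gen_y.
by rewrite ltn_predL; apply/card_gt0P; exists c0.
Qed.

End DimensionCount.

(** * Singular points of the generic forms *)

Lemma mmap1_scale (E : fieldType) (n : nat) (xi : 'I_n -> E) (c : E) (u : 'X_{1..n}) :
  c != 0 -> mmap1 xi u = c ^+ mdeg u * mmap1 (fun k => xi k / c) u.
Proof.
move=> c0; rewrite /mmap1 mdegE -prodrXr -big_split; apply: eq_bigr => k _ /=.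
by rewrite -exprMn mulrC divfK.
Qed.

(** A zero left kernel would mean rank p, hence a nonzero minor of size p; the case p > q, without
    minors, is included. *)
Lemma row_kernel (F : fieldType) (p q : nat) (A : 'M[F]_(p, q)) :
  (forall x, x \in minors p A -> x = 0) -> exists2 v : 'rV[F]_p, v != 0 & v *m A = 0.
Proof.
move=> minors0; have : kermx A != 0.
  rewrite kermx_eq0; apply/negP => /eqP/esym/nonzero_minor[x /minors0->].
  by rewrite eqxx.
by case/rowV0Pn => v /sub_kermxP vA v0; exists v.
Qed.

Section GenericForms.
Variables (K : fieldType) (n m : nat) (d : 'I_m -> nat).
Hypotheses (m_gt0 : (0 < m)%N) (d_ge2 : forall i, (2 <= d i)%N).

Let phi := @tofrac (coord_ring K n d).

Section Specialization.
Variables (E : fieldType) (psi : {rmorphism {mpoly (coord_ring K n d)[n]} -> E}).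

Let xi k : E := psi 'X_k.
Let y j (a : expo n (d j)) : E := psi (coord_var K a)%:MP.

Lemma specialize_monomial (u : 'X_{1..n}) : psi 'X_[u] = mmap1 xi u.
Proof.
by rewrite mpolyXE_id rmorph_prod; apply: eq_bigr => k _; rewrite rmorphXn.
Qed.

Lemma specialize_generic_form j :
  psi (generic_form K n d j) = \sum_(a : expo n (d j)) y a * mmap1 xi (expo_mnm a).
Proof.
rewrite rmorph_sum; apply: eq_bigr => a _.
by rewrite -mul_mpolyC rmorphM specialize_monomial.
Qed.

Lemma specialize_gradient j k : psi (generic_form K n d j)^`M(k) =
  \sum_(a : expo n (d j)) y a * (expo_mnm a k)%:R * mmap1 xi (expo_mnm a - U_(k))%MM.
Proof.
rewrite /generic_form (linear_sum (mderiv k)) rmorph_sum; apply: eq_bigr => a _ /=.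
rewrite mderivZ mderivX -!mul_mpolyC !rmorphM specialize_monomial mulrA.
by rewrite mpolyC_nat rmorph_nat.
Qed.

(* The forms vanish at xi, where their gradients satisfy a linear relation
   with coefficients v; dividing by powers of xi_i normalizes both. *)
Lemma generic_singular_point (i : 'I_n) :
  (forall h, h \in generic_gens K n d -> psi h = 0) -> psi 'X_i != 0 ->
  exists2 F : coord_ring K n d, F != 0 & psi F%:MP = 0.
Proof.
move=> psi0 xi_neq0; have d_gt0 j : (0 < d j)%N by apply: leq_trans (d_ge2 j).
have [v v0 vJ] : exists2 v : 'rV_m, v != 0 &
    v *m map_mx psi (jacobian (@generic_form K n m d)) = 0.
  apply: row_kernel => x; rewrite map_minors => /mapP[h minor_h ->].
  by apply: psi0; rewrite mem_cat minor_h.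
have [j0 vj0] : exists j, v 0 j != 0.
  by case/rV0Pn: v0 => j; exists j.
pose c := psi 'X_i; pose eta k := xi k / c.
(* The gradient of the j-th form has degree d j - 1; this power of c compensates for the rescaling
   of the point. *)
pose w j := v 0 j * c ^+ (d j - 1).
have w0 : w j0 != 0 by rewrite mulf_neq0 // expf_neq0.
have [||j|k|F F0 FE] := @singular_forms_dependent K n m d d_gt0 E
    (psi \o (@mpolyC n _ \o @mpolyC #|coord_index n d| K)) y eta (fun j => w j / w j0) i j0.
- by rewrite /eta divff.
- by rewrite divff.
- have : psi (generic_form K n d j) = 0.
    by apply: psi0; rewrite mem_cat orbC map_f // mem_enum.
  rewrite specialize_generic_form => form0.
  apply: (mulfI (expf_neq0 (d j) xi_neq0)); rewrite mulr0 -[RHS]form0 mulr_sumr.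
  by apply: eq_bigr => a _; rewrite [in RHS](mmap1_scale _ _ xi_neq0) mdeg_expo mulrCA.
- have := congr1 (fun u : 'rV_n => u 0 k) vJ; rewrite !mxE => grad0.
  apply: (mulfI w0); rewrite mulr0 -[RHS]grad0 mulr_sumr; apply: eq_bigr => j _.
  rewrite !mxE specialize_gradient mulrA mulrCA divff // mulr1 -mulrA; congr (_ * _).
  rewrite mulr_sumr; apply: eq_bigr => a _.
  (* When X_k is absent the truncated exponent does not have degree d j - 1, but the term is
     zero. *)
  have [->|ak] := eqVneq (expo_mnm a k) 0%N; first by rewrite !(mulr0, mul0r).
  rewrite [in RHS](mmap1_scale _ _ xi_neq0) -/c -/eta.
  have -> : mdeg (expo_mnm a - U_(k))%MM = (d j - 1)%N.
    have le_k : (U_(k) <= expo_mnm a)%MM by rewrite lep1mP.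
    have := congr1 mdeg (submK le_k); rewrite mdegD mdeg1 mdeg_expo => dE.
    by rewrite -[in RHS]dE addnK.
  by rewrite mulrCA.
exists F => //; rewrite -[RHS]FE [F in LHS]mpolyE !rmorph_sum; apply: eq_bigr => u _.
rewrite -mul_mpolyC !rmorphM; congr (_ * _).
rewrite mpolyXE_id !rmorph_prod; apply: eq_bigr => k _.
rewrite !rmorphXn /y /coord_var.
have -> : Tagged (fun j => expo n (d j)) (tagged (enum_val k)) = enum_val k.
  by case: (enum_val k).
by rewrite enum_valK.
Qed.

End Specialization.

(** Otherwise some domain over the fraction field has a singular common zero with X_i nonzero. A
    nonzero F in the coordinate ring would then map to 0, although it is a unit in the fraction
    field. *)
Lemma generic_powers (i : 'I_n) : exists N,
  in_ideal (map (map_mpoly phi) (generic_gens K n d)) ('X_i ^+ N).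
Proof.
apply: boolp.contrapT => noN.
have [|D [f [f_gens fXi]]] :=
    @domain_avoiding _ (map (map_mpoly phi) (generic_gens K n d)) 'X_i.
  by move=> N XN; apply: noN; exists N.
pose psi := (@tofrac D) \o f \o (map_mpoly phi).
have [h Gh||F F0] := @generic_singular_point {fraction D} psi i.
- by rewrite /psi /= f_gens ?tofrac0 //; apply/mem_in_ideal/map_f.
- by rewrite /psi /= map_mpolyX tofrac_eq0.
rewrite /psi /= map_mpolyC => /eqP; rewrite tofrac_eq0 => /eqP fF.
have /eqP := oner_neq0 D; case.
have phiF : phi F != 0 by rewrite /phi tofrac_eq0.
by rewrite -(rmorph1 f) -mpolyC1 -(mulVf phiF) mpolyCM rmorphM fF mulr0.
Qed.

End GenericForms.

(** * Specialization to points *)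

Section Points.
Variables (K : fieldType) (n m : nat) (d : 'I_m -> nat).

Definition point_eval (v : forall j, coef_space K n (d j)) (k : 'I_#|coord_index n d|) : K :=
  v (tag (enum_val k)) (tagged (enum_val k)).

Lemma map_generic_gens (v : forall j, coef_space K n (d j)) (lambda : 'I_m -> K)
    (f : 'I_m -> {mpoly K[n]}) :
  (forall j, f j \is (d j).-homog) -> (forall j, v j = lambda j *: coefs (d j) (f j)) ->
  map (map_mpoly (meval (point_eval v))) (generic_gens K n d) =
  minors_and_forms (fun j => lambda j *: f j).
Proof.
move=> fd vE; rewrite map_minors_and_forms; congr minors_and_forms.
apply: boolp.funext => j; rewrite [f j in RHS](homog_expoE (fd j)) scaler_sumr.
rewrite /generic_form rmorph_sum; apply: eq_bigr => a _.
rewrite /= map_mpolyZ map_mpolyX /= mevalXU /point_eval enum_rankK /= vE !ffunE.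
by rewrite scalerA.
Qed.

(** Scaling the rows multiplies each minor by the product of the scalars. *)
Lemma scaled_minors_and_forms (lambda : 'I_m -> K) (f : 'I_m -> {mpoly K[n]}) g :
  g \in minors_and_forms (fun j => lambda j *: f j) -> in_ideal (minors_and_forms f) g.
Proof.
rewrite mem_cat => /orP[/imageP[[u v] uv ->]|/mapP[j _ ->]]; last first.
  by rewrite -mul_mpolyC; apply/in_idealMl/mem_in_ideal; rewrite mem_cat orbC map_f // mem_enum.
have -> : mxsub u v (jacobian (fun j => lambda j *: f j)) =
    diag_mx (\row_i (lambda (u i))%:MP) *m mxsub u v (jacobian f).
  apply/matrixP => i j; rewrite mul_diag_mx !mxE mderivZ mul_mpolyC //.
rewrite /= det_mulmx; apply/in_idealMl/mem_in_ideal.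
by rewrite mem_cat; apply/orP; left; apply/imageP; exists (u, v).
Qed.

End Points.

(** * Height criterion and nonemptiness of the open set *)

Theorem theorem3p2 (K : fieldType) (K_infinite : forall s : seq K, exists x, x \notin s)
    (n : nat) (n_ge2 : (2 <= n)%N)
    (m : nat) (m_gt0 : (0 < m)%N) (d : 'I_m -> nat)
    (d_ge2 : forall i, (2 <= d i)%N)
    (d_mono : forall i j : 'I_m, (i <= j)%N -> (d i <= d j)%N) :
  (forall f : forall i, nzform K n (d i),
     has_height (in_ideal (minors_and_forms (fun i => sval (f i)))) n
     <-> U_set (t0 K n d) (tau f))
  /\ (exists x : param_space K n d, U_set (t0 K n d) x).

Proof.
have n_gt0 : (0 < n)%N by apply: ltnW.
split=> [f|].
  have fd i : sval (f i) \is (d i).-homog by case: (f i) => g /= /andP[].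
  set J := minors_and_forms _.
  have J_homog g : g \in J -> exists2 e, (0 < e)%N & g \is e.-homog.
    exact: minors_and_forms_homog.
  rewrite (has_heightP J_homog); split=> [powJ zeroU|].
    pose v j := coefs (d j) (sval (f j)).
    have vE j : v j = 1 *: coefs (d j) (sval (f j)) by rewrite scale1r.
    have JE : map (map_mpoly (meval (point_eval v))) (generic_gens K n d) = J.
      rewrite (map_generic_gens fd vE); congr minors_and_forms.
      by apply: boolp.funext => j; rewrite scale1r.
    have [F minF /eqP[]] := (minor_criterion n_gt0 m_gt0 d_ge2
      (meval (point_eval v)) K_infinite).2 (eq_rect_r (fun G => forall i, exists N,
        in_ideal G ('X_i ^+ N)) powJ JE).
    apply: (zeroU F (mem_in_ideal minF) v) => j; split; first exact: memv_line.
    by have := dim_coefs_line (f j); rewrite dim_vline eqb1.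
  pose M := minors 'C(t0 K n d + n - 1, n - 1) (Nmx K n d (t0 K n d)).
  (* An element of the ideal of minors nonzero at v forces some minor to be nonzero there. *)
  move=> Uf; have [F [v [minF v_line Fv]]] : exists F v,
      [/\ F \in M, forall j, v j \in <[coefs (d j) (sval (f j))]>%VS &
          F.@[point_eval v] != 0].
    apply: boolp.contrapT => noF; apply: Uf => F [c ->] v v_line.
    rewrite -/(point_eval v) raddf_sum big1 // => k _; rewrite /= mevalM.
    suff -> : (M`_k).@[point_eval v] = 0 by rewrite mulr0.
    apply/eqP; apply: contra_notT noF => Fv; exists M`_k, v; split=> // [|j].
      exact: mem_nth.
    by case: (v_line j).
  have /boolp.choice[lambda vE] : forall j, exists l, v j = l *: coefs (d j) (sval (f j)).
    by move=> j; apply/vlineP.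
  have := (minor_criterion n_gt0 m_gt0 d_ge2 (meval (point_eval v)) K_infinite).1.
  rewrite (map_generic_gens fd vE) => crit i.
  have [|N XN] := crit _ i; first by exists F.
  by exists N; apply: in_ideal_trans XN => g; apply: scaled_minors_and_forms.
pose S := {mpoly K[#|coord_index n d|]}.
have L_infinite : forall s : seq {fraction S}, exists x, x \notin s.
  apply: (infinite_codomain (g := fun c : K => @tofrac S c%:MP)) => // a b.
  by move/eqP; rewrite tofrac_eq mpolyC_eq => /eqP.
(* Over the fraction field the criterion yields a minor that is a nonzero polynomial. *)
have [F minF] := (minor_criterion n_gt0 m_gt0 d_ge2 (@tofrac S) L_infinite).2
  (@generic_powers K n m d d_ge2).
rewrite tofrac_eq0 => F0.
have ex_expo j : exists a : expo n (d j), expo_mnm a = (U_(Ordinal n_gt0) *+ d j)%MM.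
  by apply: expo_mnm_exists; rewrite mdeg_power.
pose a j := sval (boolp.cid (ex_expo j)).
(* Multiplying F by one variable from each factor ensures that all components of v are nonzero, so
   that they define a point. *)
have [|v] := mpoly_nonvanishing K_infinite (F := F * \prod_j coord_var K (a j)).
  by rewrite mulf_neq0 //; apply/prodf_neq0 => j _; apply: mpolyX_neq0.
rewrite mevalM mulf_eq0 negb_or rmorph_prod => /andP[Fv /prodf_neq0 av].
pose w j : coef_space K n (d j) :=
  [ffun b => v (enum_rank (Tagged (fun j => expo n (d j)) b))].
have w0 j : w j != 0.
  apply: contraTneq (av j isT) => wj0; have /ffunP/(_ (a j)) := wj0.
  by rewrite !ffunE /= mevalXU negbK => ->.
have dim_w j : \dim <[w j]>%VS == 1%N by rewrite dim_vline eqb1 w0.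
exists (fun j => ProjPoint (dim_w j)) => /(_ F (mem_in_ideal minF) w) Fw.
case/eqP: Fv; rewrite -[RHS]Fw => [|j]; last by split; [apply: memv_line | apply: w0].
apply: meval_eq => k; rewrite ffunE.
have -> : Tagged (fun j => expo n (d j)) (tagged (enum_val k)) = enum_val k.
  by case: (enum_val k).
by rewrite enum_valK.
Qed.
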